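(* For every $x\in(\lambda,\lambda^{-1})$, the game $\mathrm{Standard}(x)=\mathrm{Trail}(0,1,x,0)$ has at least two time-invariant Nash equilibria that are not shift equivalent.
   Context: Trail of Lost Pennies $\mathrm{Trail}(m_{-\infty},m_\infty,n_{-\infty},n_\infty)$ (data with $m_{-\infty}<m_\infty$, $n_\infty<n_{-\infty}$, and fixed reals $m_*\le m_{-\infty}$, $n_*\le n_\infty$): a strategy is a map $S:\mathbb{Z}\times\mathbb{N}_+\to[0,\infty)$, time-invariant if $S(i,j)$ does not depend on $j$. For a strategy pair $(S_-,S_+)$ (Mina's, Maxine's) and $k\in\mathbb{Z}$, gameplay $X:\mathbb{N}\to\mathbb{Z}$ has $X_0=k$ and, given the past, steps $+1$ with probability $\frac{S_+(X_{i-1},i)}{S_-(X_{i-1},i)+S_+(X_{i-1},i)}$ and $-1$ otherwise ($0/0=1/2$). With $E_-=\{\limsup X_n=-\infty\}$, $E_+=\{\liminf X_n=\infty\}$, $E=E_-\cup E_+$: Mina's payoff $P_-=-\sum_{t\ge1}S_-(X_{t-1},t)+T_-$, $T_-=n_{-\infty},n_\infty,n_*$ on $E_-,E_+,E^c$; Maxine's payoff $P_+=-\sum_{t\ge1}S_+(X_{t-1},t)+T_+$, $T_+=m_{-\infty},m_\infty,m_*$ on $E_-,E_+,E^c$. $(S_-,S_+)$ is a Nash equilibrium if for every strategy $S$ and every starting point $k$, $\mathbb{E}^k_{S_-,S_+}[P_+]\ge\mathbb{E}^k_{S_-,S}[P_+]$ and $\mathbb{E}^k_{S_-,S_+}[P_-]\ge\mathbb{E}^k_{S,S_+}[P_-]$.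 Time-invariant pairs are written $\{(b_i,a_i):i\in\mathbb{Z}\}$; two such pairs are shift equivalent if there is $k\in\mathbb{Z}$ with $(b_i,a_i)=(b'_{i+k},a'_{i+k})$ for all $i$. $\lambda\in(0,1]$ denotes the infimum of the Mina margins $\frac{n_{-\infty}-n_\infty}{m_\infty-m_{-\infty}}$ of positive solutions of the ABMN system (variables $a_i,b_i>0$, $m_i,n_i\in\mathbb{R}$ with, for all $i$, $(a_i+b_i)(m_i+a_i)=a_im_{i+1}+b_im_{i-1}$, $(a_i+b_i)(n_i+b_i)=a_in_{i+1}+b_in_{i-1}$, $(a_i+b_i)^2=b_i(m_{i+1}-m_{i-1})$, $(a_i+b_i)^2=a_i(n_{i-1}-n_{i+1})$; $m_{\pm\infty},n_{\pm\infty}$ the limits as $i\to\pm\infty$); the set of these margins equals $[\lambda,\lambda^{-1}]$ and $\lambda<1$. *)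

(* Defs.v *)
From HB Require Import structures.
From mathcomp Require Import all_boot all_order all_algebra.
From mathcomp Require Import all_classical all_reals all_analysis.
Set Implicit Arguments. Unset Strict Implicit. Unset Printing Implicit Defensive.
Import Order.TTheory GRing.Theory Num.Theory.
Import numFieldNormedType.Exports.
Local Open Scope classical_set_scope.
Local Open Scope ring_scope.

Section TrailDefs.
Variable R : realType.

(** A strategy: a map Z x N_+ -> [0,oo).  We use [int -> nat -> R]; the
    value at time index 0 is never used (times start at 1). *)
Definition strategy := int -> nat -> R.
Definition is_strategy (S : strategy) : Prop :=
  forall (i : int) (t : nat), 0 <= S i t.

(** Probability of an upward step when Mina stakes [sm] and Maxine [sp];
    with the convention 0/0 = 1/2. *)
Definition up_prob (sm sp : R) : R :=
  if sm + sp == 0 then 2^-1 else sp / (sm + sp).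

(** Transition probability from [x] to [y] at step [t] (t >= 1), i.e. the
    step X_{t-1} = x -> X_t = y, using stakes S(x,t). *)
Definition trans (Sm Sp : strategy) (t : nat) (x y : int) : R :=
  let p := up_prob (Sm x t) (Sp x t) in
  if y == x + 1 then p else if y == x - 1 then 1 - p else 0.

(** [X] is a realization, on the probability space [P], of the gameplay
    of the strategy pair (Sm, Sp) started at [k]: each [X n] is a
    (discrete) random variable, and the finite-dimensional distributions are
    those of the Markov chain with initial state k and the above transitions. *)
Definition gameplay d (T : measurableType d) (P : probability T R)
  (X : nat -> T -> int) (Sm Sp : strategy) (k : int) : Prop :=
  (forall (n : nat) (z : int), measurable (X n @^-1` [set z])) /\
  (forall (n : nat) (xs : nat -> int),
     P [set w | forall i : nat, (i <= n)%N -> X i w = xs i] =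
     (((xs 0%N == k)%:R * \prod_(1 <= i < n.+1) trans Sm Sp i (xs i.-1) (xs i))%:E)%E).

Definition terminal (x : nat -> int) (v_minus v_plus v_star : R) : \bar R :=
  if limn_esup (fun n => ((x n)%:~R : R)%:E) == -oo%E then v_minus%:E
  else if limn_einf (fun n => ((x n)%:~R : R)%:E) == +oo%E then v_plus%:E
  else v_star%:E.

Definition payoff (x : nat -> int) (S : strategy) (v_minus v_plus v_star : R)
  : \bar R :=
  (- (\sum_(1 <= t <oo) ((S (x t.-1) t)%:E)) + terminal x v_minus v_plus v_star)%E.

Record trail_game := TrailGame {
  m_minf : R; m_inf : R; n_minf : R; n_inf : R; m_star : R; n_star : R }.

Definition maxine_payoff (G : trail_game) (x : nat -> int) (Sp : strategy) :=
  payoff x Sp (m_minf G) (m_inf G) (m_star G).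
Definition mina_payoff (G : trail_game) (x : nat -> int) (Sm : strategy) :=
  payoff x Sm (n_minf G) (n_inf G) (n_star G).

Definition nash_equilibrium (G : trail_game) (Sm Sp : strategy) : Prop :=
  is_strategy Sm /\ is_strategy Sp /\
  forall (S : strategy), is_strategy S -> forall k : int,
    (forall d1 (T1 : measurableType d1) (P1 : probability T1 R) (X : nat -> T1 -> int)
            d2 (T2 : measurableType d2) (P2 : probability T2 R) (Y : nat -> T2 -> int),
       gameplay P1 X Sm Sp k -> gameplay P2 Y Sm S k ->
       (\int[P2]_w maxine_payoff G (Y ^~ w) S <=
        \int[P1]_w maxine_payoff G (X ^~ w) Sp)%E) /\
    (forall d1 (T1 : measurableType d1) (P1 : probability T1 R) (X : nat -> T1 -> int)
            d2 (T2 : measurableType d2) (P2 : probability T2 R) (Y : nat -> T2 -> int),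
       gameplay P1 X Sm Sp k -> gameplay P2 Y S Sp k ->
       (\int[P2]_w mina_payoff G (Y ^~ w) S <=
        \int[P1]_w mina_payoff G (X ^~ w) Sm)%E).

(** Time-invariant strategy pair {(b_i, a_i)}: Mina stakes b_i, Maxine a_i. *)
Definition ti_strategy (c : int -> R) : strategy := fun i _ => c i.

Definition shift_equivalent (b a b' a' : int -> R) : Prop :=
  exists k : int, forall i : int, b i = b' (i + k) /\ a i = a' (i + k).

Definition ABMN_positive (a b m n : int -> R) (mm mp nm np : R) : Prop :=
  (forall i, 0 < a i) /\ (forall i, 0 < b i) /\
  (forall i, (a i + b i) * (m i + a i) = a i * m (i + 1) + b i * m (i - 1)) /\
  (forall i, (a i + b i) * (n i + b i) = a i * n (i + 1) + b i * n (i - 1)) /\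
  (forall i, (a i + b i) ^+ 2 = b i * (m (i + 1) - m (i - 1))) /\
  (forall i, (a i + b i) ^+ 2 = a i * (n (i - 1) - n (i + 1))) /\
  ((fun k : nat => m k%:Z) @ \oo --> mp) /\
  ((fun k : nat => m (- k%:Z)) @ \oo --> mm) /\
  ((fun k : nat => n k%:Z) @ \oo --> np) /\
  ((fun k : nat => n (- k%:Z)) @ \oo --> nm).

Definition mina_margins : set R :=
  [set r | exists a b m n mm mp nm np,
     ABMN_positive a b m n mm mp nm np /\ r = (nm - np) / (mp - mm)].

Definition lambda_ABMN : R := inf mina_margins.

Definition standard_game (x mstar nstar : R) : trail_game :=
  TrailGame 0 1 x 0 mstar nstar.

End TrailDefs.

(* Main.v *)
Require Import Defs.
From HB Require Import structures.
From mathcomp Require Import all_boot all_order all_algebra.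
From mathcomp Require Import all_classical all_reals all_analysis.
From mathcomp Require Import measurable_realfun ring lra zify.
Set Implicit Arguments. Unset Strict Implicit. Unset Printing Implicit Defensive.
Import Order.TTheory GRing.Theory Num.Theory.
Import numFieldNormedType.Exports.
Local Open Scope classical_set_scope.
Local Open Scope ring_scope.

(** In an ABMN solution the ratio [y_i = b_i / a_i] follows the recursion
    [y' (2 y' + 1) (2 + y) = y ^ 2], and [y_0] determines the solution up to
    scaling and translation.  The Mina margin is thus a function of [y_0]; it is
    given by rapidly convergent series, hence continuous, it is constant along
    orbits of the recursion, and exchanging the players turns [y_0] into its
    inverse and the margin into its inverse.  So it is a continuous function on
    the circle of orbits, and any value strictly between two others is attained
    on both of the arcs they cut out: this gives two solutions that are not
    shifts of each other.

    An ABMN solution is an equilibrium because, against the opponent's stakes,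
    [m] along the gameplay minus Maxine's expenses is a supermartingale whatever
    she stakes, and a martingale when she stakes [a]; likewise for Mina.  In the
    martingale case the total expense has finite mean, and since each visit to a
    site costs a fixed positive amount, almost every path leaves every site and
    tends to one of the infinities. *)

(** * The recursion on stake ratios *)

Section RatioMap.
Variable R : realType.
Implicit Types y z K : R.

(** The positive root [z] of [z (2 z + 1) = y ^ 2 / (2 + y)], by the quadratic formula. *)
Definition step y : R := (Num.sqrt (1 + 8 * (y ^+ 2 / (2 + y))) - 1) / 4.

Lemma stepE y : 0 < y -> step y * (2 * step y + 1) * (2 + y) = y ^+ 2.
Proof.
move=> y0; rewrite /step.
set q := y ^+ 2 / (2 + y).
have q0 : 0 <= q by rewrite divr_ge0 ?sqr_ge0//; lra.
have hs : Num.sqrt (1 + 8 * q) ^+ 2 = 1 + 8 * q by rewrite sqr_sqrtr//; lra.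
set s := Num.sqrt _ in hs *.
have -> : (s - 1) / 4 * (2 * ((s - 1) / 4) + 1) = (s ^+ 2 - 1) / 8 by field.
by rewrite hs /q; field; lra.
Qed.

Lemma step_gt0 y : 0 < y -> 0 < step y.
Proof.
move=> y0; rewrite /step divr_gt0// subr_gt0 -[ltLHS]sqrtr1 ltr_sqrt; last first.
  by have : 0 < y ^+ 2 / (2 + y) by [rewrite divr_gt0 ?exprn_gt0//; lra]; lra.
by have : 0 < y ^+ 2 / (2 + y) by [rewrite divr_gt0 ?exprn_gt0//; lra]; lra.
Qed.

Lemma step_unique y z : 0 < y -> 0 < z ->
  z * (2 * z + 1) * (2 + y) = y ^+ 2 -> z = step y.
Proof.
move=> y0 z0 e; have s0 := step_gt0 y0; have := stepE y0; rewrite -e => h.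
have {}h : step y * (2 * step y + 1) = z * (2 * z + 1).
  by apply: (mulIf _ h); lra.
have : (step y - z) * (2 * (step y + z) + 1) = 0 by lra.
by move/eqP; rewrite mulf_eq0 => /orP[/eqP|/eqP]; lra.
Qed.

Lemma step_le_half y : 0 < y -> step y <= y / 2.
Proof. by move=> y0; have := stepE y0; have := step_gt0 y0; nra. Qed.

Lemma step_lt y z : 0 < y -> y < z -> step y < step z.
Proof.
move=> y0 yz; have z0 : 0 < z by lra.
have sy := stepE y0; have sz := stepE z0.
have := step_gt0 y0; have := step_gt0 z0; rewrite ltNge => s1 s2; apply/negP => h.
set p := step y in sy s2 h; set q := step z in sz s1 h.
have : q * (2 * q + 1) <= p * (2 * p + 1) by nra.
move: (q * _) (p * _) sy sz => Q P eP eQ QP.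
(* This is monotonicity of [y ^ 2 / (2 + y)], cleared of denominators; the difference of the two
   sides factors as shown in the next line. *)
have : y ^+ 2 * (2 + z) < z ^+ 2 * (2 + y).
  have : 0 < (z - y) * (2 * (z + y) + y * z) by apply: mulr_gt0; nra.
  by lra.
rewrite -eP -eQ => ?.
have : P * ((2 + y) * (2 + z)) < Q * ((2 + y) * (2 + z)) by lra.
by rewrite ltr_pM2r; [lra | nra].
Qed.

(* The recursion is invariant under exchanging the players, which inverts
   the ratio and reverses the line. *)
Lemma step_reflect y : 0 < y -> step (step y)^-1 = y^-1.
Proof.
move=> y0; have s0 := step_gt0 y0; have e := stepE y0.
apply/esym/step_unique; rewrite ?invr_gt0//.
set s := step y in s0 e *.
have s0' : s != 0 by lra. have y0' : y != 0 by lra.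
apply: (mulIf (x := s ^+ 2 * y ^+ 2)); first by rewrite mulf_neq0// expf_neq0.
rewrite [RHS](_ : _ = y ^+ 2); last by field.
by rewrite -[RHS]e; field; rewrite s0' y0'.
Qed.

Lemma step_continuous y : 0 < y -> {for y, continuous step}.
Proof.
move=> y0; rewrite /step; apply: cvgM; last exact: cvg_cst.
apply: cvgB; last exact: cvg_cst.
apply: (@continuous_comp _ _ _ (fun y : R => 1 + 8 * (y ^+ 2 / (2 + y))) Num.sqrt);
  last exact: sqrt_continuous.
apply: cvgD; first exact: cvg_cst.
apply: cvgM; first exact: cvg_cst.
apply: cvgM; first exact: exprn_continuous.
apply: cvgV; first by lra.
by apply: cvgD; [exact: cvg_cst|exact: cvg_id].
Qed.

Definition sorbit y j : R := iter j step y.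

Lemma sorbitS y j : sorbit y j.+1 = step (sorbit y j). Proof. by []. Qed.

Lemma sorbitSr y j : sorbit y j.+1 = sorbit (step y) j.
Proof. by rewrite /sorbit iterSr. Qed.

Lemma sorbit_gt0 y j : 0 < y -> 0 < sorbit y j.
Proof. by move=> y0; elim: j => //= j; exact: step_gt0. Qed.

Lemma sorbit_le y j : 0 < y -> sorbit y j <= y / 2 ^+ j.
Proof.
move=> y0; elim: j => [|j IH]; first by rewrite expr0 divr1.
rewrite sorbitS (le_trans (step_le_half (sorbit_gt0 j y0)))//.
by rewrite exprS invfM mulrCA mulrC ler_pM2l// invr_gt0.
Qed.

Lemma sorbit_le_self y j : 0 < y -> sorbit y j <= y.
Proof.
move=> y0; rewrite (le_trans (sorbit_le j y0))// ler_pdivrMr ?exprn_gt0//.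
by rewrite ler_peMr ?(ltW y0)// exprn_ege1// ler1n.
Qed.

Lemma sorbit_lt_some y z : 0 < y -> 0 < z -> exists j, sorbit y j < z.
Proof.
move=> y0 z0.
(* The orbit at least halves at each step, and [y / z < N < 2 ^ N] for this [N]. *)
exists (Num.truncn (y / z)).+1.
have h := truncnS_gt (y / z).
set N := (Num.truncn _).+1 in h *.
apply: (le_lt_trans (sorbit_le N y0)).
rewrite ltr_pdivrMr ?exprn_gt0//; rewrite ltr_pdivrMr// in h.
rewrite (lt_trans h)// mulrC ltr_pM2l// -natrX ltr_nat.
exact: ltn_expl.
Qed.

Lemma sorbit_continuous j y : 0 < y -> {for y, continuous (sorbit ^~ j)}.
Proof.
move=> y0; elim: j => [|j IH]; first exact: cvg_id.
apply: (@continuous_comp _ _ _ (sorbit ^~ j) step) => //.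
exact/step_continuous/sorbit_gt0.
Qed.

(* The stakes of Maxine along the orbit satisfy [a_{i+1} = gain y_i * a_i]. *)
Definition gain y : R := step y * (2 + y).

(** The quotient [a_j / a_0] in a solution with [b_0 / a_0 = y]. *)
Definition weight y j : R := \prod_(i < j) gain (sorbit y i).

Lemma gain_gt0 y : 0 < y -> 0 < gain y.
Proof. by move=> y0; rewrite /gain mulr_gt0 ?step_gt0//; lra. Qed.

Lemma gain_le y : 0 < y -> gain y <= y ^+ 2.
Proof.
move=> y0; rewrite -(stepE y0) /gain ler_pM2r; last by lra.
by have := step_gt0 y0; nra.
Qed.

Lemma weight_gt0 y j : 0 < y -> 0 < weight y j.
Proof. by move=> y0; apply: prodr_gt0 => i _; exact/gain_gt0/sorbit_gt0. Qed.

Lemma weight0 y : weight y 0 = 1. Proof. by rewrite /weight big_ord0. Qed.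

Lemma weightS y j : weight y j.+1 = weight y j * gain (sorbit y j).
Proof. by rewrite /weight big_ord_recr. Qed.

Lemma weightSr y j : weight y j.+1 = gain y * weight (step y) j.
Proof.
rewrite /weight big_ord_recl/=; congr (_ * _); apply: eq_bigr => i _.
by rewrite -sorbitSr.
Qed.

(** The factor passing from [j] to [j + 1] is at most [(K / 2 ^ j) ^ 2 <= K ^ 2 / (j + 1)], the
    quotient of consecutive exponential coefficients. The majorant is summable and uniform in
    [y <= K]. *)
Lemma weight_le y K j : 0 < y -> y <= K -> weight y j <= exp_coeff (K ^+ 2) j.
Proof.
move=> y0 yK; have K0 : 0 < K by lra.
elim: j => [|j IH]; first by rewrite weight0 /exp_coeff/= expr0 fact0 divr1.
rewrite weightS /exp_coeff/= factS mulnC natrM invfM exprSr mulrACA.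
apply: ler_pM => //; first exact/ltW/weight_gt0; first exact/ltW/gain_gt0/sorbit_gt0.
apply: (le_trans (gain_le (sorbit_gt0 j y0))).
have h : sorbit y j <= K / 2 ^+ j.
  by rewrite (le_trans (sorbit_le j y0))// ler_pM2r// invr_gt0 exprn_gt0.
apply: (@le_trans _ _ ((K / 2 ^+ j) ^+ 2)).
  by rewrite lerXn2r// nnegrE ?divr_ge0// ltW// ?exprn_gt0//; exact: sorbit_gt0.
rewrite expr_div_n ler_pM2l ?exprn_gt0// lef_pV2 ?posrE ?exprn_gt0 ?ltr0n//.
rewrite -exprM -natrX ler_nat.
by rewrite (leq_trans (ltn_expl j (ltnSn 1)))// leq_exp2l// muln2 -addnn leq_addr.
Qed.

Lemma gain_continuous y : 0 < y -> {for y, continuous gain}.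
Proof.
move=> y0; apply: cvgM; first exact: step_continuous.
by apply: cvgD; [exact: cvg_cst|exact: cvg_id].
Qed.

Lemma weight_continuous j y : 0 < y -> {for y, continuous (weight ^~ j)}.
Proof.
move=> y0; elim: j => [|j IH].
  have -> : weight^~ 0%N = cst 1 by apply/funext => z; rewrite weight0.
  exact: cvg_cst.
have -> : weight^~ j.+1 = (weight^~ j) \* (gain \o sorbit ^~ j).
  by apply/funext => z; rewrite weightS.
apply: cvgM => //.
apply: continuous_comp; first exact: sorbit_continuous.
exact/gain_continuous/sorbit_gt0.
Qed.

End RatioMap.

(** * Series along an orbit and their continuity *)

Section WeightedSeries.
Variable R : realType.
Variable g : R -> R.
Hypothesis g_ge0 : forall z : R, 0 < z -> 0 <= g z.
Hypothesis g_le : forall z z' : R, 0 < z -> z <= z' -> g z <= g z'.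
Hypothesis g_cont : continuous g.
Implicit Types y K : R.

(** For [a_0 = 1], the choices [g z = 2 + z] and [g z = z ^ 2] make this term the rise of [m],
    respectively the fall of [n], from site [j] to [j + 1]. *)
Definition wterm y : R^nat := fun j => weight y j * g (sorbit y j).

Definition wsum y : R := limn (series (wterm y)).

Lemma wterm_ge0 y j : 0 < y -> 0 <= wterm y j.
Proof.
by move=> y0; rewrite mulr_ge0 ?(ltW (weight_gt0 _ y0))// g_ge0// sorbit_gt0.
Qed.

Lemma wterm_le y K j : 0 < y -> y <= K ->
  wterm y j <= g K * exp_coeff (K ^+ 2) j.
Proof.
move=> y0 yK; rewrite /wterm mulrC ler_pM//.
- exact/g_ge0/sorbit_gt0.
- exact/ltW/weight_gt0.
- by apply: g_le; [exact: sorbit_gt0 | exact: le_trans (sorbit_le_self j y0) yK].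
- exact: weight_le.
Qed.

Lemma is_cvg_wsum y : 0 < y -> cvgn (series (wterm y)).
Proof.
move=> y0; apply: (@series_le_cvg _ _ (fun j => g y * exp_coeff (y ^+ 2) j)).
- by move=> j; exact: wterm_ge0.
- by move=> j; rewrite mulr_ge0 ?g_ge0// exp_coeff_ge0// sqr_ge0.
- by move=> j; exact: wterm_le.
- exact/is_cvg_seriesZ/is_cvg_series_exp_coeff.
Qed.

Lemma wsum_ge_partial y N : 0 < y -> series (wterm y) N <= wsum y.
Proof.
move=> y0; apply: nondecreasing_cvgn_le; last exact: is_cvg_wsum.
apply/nondecreasing_seqP => n; rewrite /series/= big_nat_recr//= lerDl.
exact: wterm_ge0.
Qed.

Lemma wsum_ge y : 0 < y -> g y <= wsum y.
Proof.
move=> y0; have := wsum_ge_partial 1 y0.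
by rewrite /series/= big_nat1 /wterm weight0 mul1r.
Qed.

(** After the first term, the orbit restarts at [step y] and all weights share the factor
    [gain y]. *)
Lemma wsum_step y : 0 < y -> wsum y = g y + gain y * wsum (step y).
Proof.
move=> y0; apply/cvg_lim => //; rewrite -(cvg_shiftS (series (wterm y))).
apply: (@cvg_trans _ ((fun n => g y + gain y * series (wterm (step y)) n) @ \oo)).
  apply: near_eq_cvg; near=> n; rewrite /series/= big_nat_recl//.
  rewrite /wterm weight0 mul1r mulr_sumr; congr (_ + _).
  by apply: eq_bigr => i _; rewrite weightSr sorbitSr mulrA.
apply: cvgD; first exact: cvg_cst.
by apply: cvgMr; exact/is_cvg_wsum/step_gt0.
Unshelve. all: by end_near. Qed.

(** Uniform in [y <= K], so the series converges locally uniformly; this carries continuity from the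
    partial sums to the limit. *)
Lemma wsum_tail y K N : 0 < y -> y <= K ->
  wsum y - series (wterm y) N <=
  g K * (expR (K ^+ 2) - series (exp_coeff (K ^+ 2)) N).
Proof.
move=> y0 yK; set e := exp_coeff (K ^+ 2).
have gK : 0 <= g K by apply: g_ge0; lra.
have e0 n : 0 <= e n by rewrite exp_coeff_ge0// sqr_ge0.
rewrite lerBlDr; apply: limr_le; first exact: is_cvg_wsum.
near=> n; have Nn : (N <= n)%N by near: n; exists N.
rewrite -lerBlDr.
apply: (@le_trans _ _ (g K * (series e n - series e N))).
  rewrite !sub_series_geq// mulr_sumr; apply: ler_sum => i _; exact: wterm_le.
rewrite ler_wpM2l// lerB//; apply: nondecreasing_cvgn_le.
  by apply/nondecreasing_seqP => k; rewrite /series/= big_nat_recr//= lerDl.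
exact: is_cvg_series_exp_coeff.
Unshelve. all: by end_near. Qed.

Lemma wsum_continuous y : 0 < y -> {for y, continuous wsum}.
Proof.
(* One bound valid for [y] and all nearby [z], so that a single [N] makes both tails at most
   [eps / 3]. *)
move=> y0; set K := y + 1.
pose E N := g K * (expR (K ^+ 2) - series (exp_coeff (K ^+ 2)) N).
have E0 : E @ \oo --> (0 : R).
  rewrite -[X in _ --> X](mulr0 (g K)) -(subrr (expR (K ^+ 2))).
  apply: cvgMr; apply: cvgB; first exact: cvg_cst.
  exact: is_cvg_series_exp_coeff.
apply/cvgrPdist_le => eps eps0.
have [N _ hN] : \forall n \near \oo, E n <= eps / 3.
  have /cvgrPdist_le /(_ (eps / 3)) := E0.
  move=> /(_ ltac:(by rewrite divr_gt0)); apply: filterS => n.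
  by rewrite sub0r normrN => /(le_trans (ler_norm _)).
have {}hN := hN N (leqnn N).
have cN : {for y, continuous (fun z => series (wterm z) N)}.
  rewrite /series/=.
  elim: N {hN} => [|n IH].
    rewrite (_ : (fun z => _) = cst 0); first exact: cvg_cst.
    by apply/funext => z; rewrite big_geq.
  rewrite (_ : (fun z => _) =
      (fun z => \sum_(0 <= k < n) wterm z k) \+ (fun z => wterm z n)); last first.
    by apply/funext => z; rewrite big_nat_recr.
  apply: cvgD => //; apply: cvgM; first exact: weight_continuous.
  by apply: continuous_comp; [exact: sorbit_continuous|exact: g_cont].
move/cvgrPdist_le : cN => /(_ (eps / 3) ltac:(by rewrite divr_gt0)) cN.
near=> z.
have z0 : 0 < z by near: z; exact: lt_nbhsr.
have zK : z <= K by near: z; apply: lt_le_nbhsl; rewrite /K; lra.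
have yK : y <= K by rewrite /K; lra.
have h1 := wsum_tail N y0 yK; have h2 := wsum_tail N z0 zK.
have h3 := wsum_ge_partial N y0; have h4 := wsum_ge_partial N z0.
have h5 : `|series (wterm y) N - series (wterm z) N| <= eps / 3 by near: z.
rewrite -/(E N) in h1 h2.
by move: h5; rewrite !ler_norml => /andP[? ?]; apply/andP; split; lra.
Unshelve. all: by end_near. Qed.

End WeightedSeries.

(** * The margin as a function of the stake ratio *)

Section Margin.
Variable R : realType.
Implicit Types y z : R.

(* [up_total y] and [down_total y] are the increments [m_oo - m_0] and
   [n_0 - n_oo] of the solution with [a_0 = 1] and [b_0 = y]. *)
Definition up_total : R -> R := wsum (fun z => 2 + z).
Definition down_total : R -> R := wsum (fun z => z ^+ 2).

Let up_ge0 z : 0 < z -> 0 <= 2 + z. Proof. by lra. Qed.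
Let up_le z z' : 0 < z -> z <= z' -> 2 + z <= 2 + z'. Proof. by lra. Qed.
Let up_cont : continuous (fun z : R => 2 + z).
Proof. by move=> z; apply: cvgD; [exact: cvg_cst|exact: cvg_id]. Qed.
Let down_ge0 z : 0 < z -> 0 <= z ^+ 2. Proof. by move=> _; exact: sqr_ge0. Qed.
Let down_le z z' : 0 < z -> z <= z' -> z ^+ 2 <= z' ^+ 2.
Proof. by move=> ? ?; rewrite lerXn2r// nnegrE; lra. Qed.
Let down_cont : continuous (fun z : R => z ^+ 2).
Proof. exact: exprn_continuous. Qed.

Lemma up_total_gt0 y : 0 < y -> 0 < up_total y.
Proof.
by move=> y0; apply: lt_le_trans (wsum_ge up_ge0 up_le y0); lra.
Qed.

Lemma down_total_gt0 y : 0 < y -> 0 < down_total y.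
Proof.
move=> y0; apply: lt_le_trans (wsum_ge down_ge0 down_le y0).
by rewrite exprn_gt0.
Qed.

Lemma up_total_step y : 0 < y -> up_total y = 2 + y + gain y * up_total (step y).
Proof. exact: wsum_step. Qed.

Lemma down_total_step y : 0 < y ->
  down_total y = y ^+ 2 + gain y * down_total (step y).
Proof. exact: wsum_step. Qed.

Lemma cvg_up_total y : 0 < y ->
  series (fun j => weight y j * (2 + sorbit y j)) @ \oo --> up_total y.
Proof. exact: is_cvg_wsum. Qed.

Lemma cvg_down_total y : 0 < y ->
  series (fun j => weight y j * sorbit y j ^+ 2) @ \oo --> down_total y.
Proof. exact: is_cvg_wsum. Qed.

(** The total rise of [m] and, next, the total fall of [n] over the whole line when [a_0 = 1] and
    [b_0 = y]. Exchanging the players turns the left half into a right half with leading stake [y]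
    and ratio [y^-1]. *)
Definition m_span y : R := up_total y + y * down_total y^-1.
Definition n_span y : R := down_total y + y * up_total y^-1.
Definition margin y : R := n_span y / m_span y.

Lemma m_span_gt0 y : 0 < y -> 0 < m_span y.
Proof.
move=> y0; rewrite addr_gt0 ?up_total_gt0// mulr_gt0//.
by rewrite down_total_gt0// invr_gt0.
Qed.

Lemma n_span_gt0 y : 0 < y -> 0 < n_span y.
Proof.
move=> y0; rewrite addr_gt0 ?down_total_gt0// mulr_gt0//.
by rewrite up_total_gt0// invr_gt0.
Qed.

Lemma margin_gt0 y : 0 < y -> 0 < margin y.
Proof. by move=> y0; rewrite divr_gt0 ?n_span_gt0 ?m_span_gt0. Qed.

(** The players' exchange gives [m_span y = y * n_span y^-1] and [n_span y = y * m_span y^-1]; the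
    factor [y] cancels in the quotient. *)
Lemma marginV y : 0 < y -> margin y^-1 = (margin y)^-1.
Proof.
move=> y0; have := m_span_gt0 y0; have := n_span_gt0 y0.
rewrite /margin invf_div /m_span /n_span invrK.
move: (up_total y) (up_total y^-1) (down_total y) (down_total y^-1) => p q r s.
move=> h1 h2; have -> : p + y * s = y * (s + y^-1 * p) by field; lra.
have -> : r + y * q = y * (q + y^-1 * r) by field; lra.
by rewrite -mulf_div divff ?mul1r//; lra.
Qed.

(** Moving the origin by one site shifts a term from the right series to the left one and rescales
    both spans by [gain y]. What remains to check is a multiple of the equation [stepE]. *)
Lemma margin_step y : 0 < y -> margin (step y) = margin y.
Proof.
move=> y0; have s0 := step_gt0 y0; have g0 := gain_gt0 y0.
have i0 : 0 < (step y)^-1 by rewrite invr_gt0.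
have e := stepE y0.
have E1 : m_span y = gain y * m_span (step y).
  rewrite /m_span up_total_step// (down_total_step i0) step_reflect// /gain step_reflect//.
  move: (up_total _) (down_total _) => p q; apply/eqP; rewrite -subr_eq0; apply/eqP.
  transitivity (q * (y - step y * (2 * step y + 1) * (2 + y) / y)).
    by field; lra.
  by rewrite e; field; lra.
have E2 : n_span y = gain y * n_span (step y).
  rewrite /n_span down_total_step// (up_total_step i0) step_reflect// /gain step_reflect//.
  move: (up_total _) (down_total _) => p q; apply/eqP; rewrite -subr_eq0; apply/eqP.
  transitivity ((y ^+ 2 - step y * (2 * step y + 1) * (2 + y)) * (1 + p / y)).
    by field; lra.
  by rewrite e; field; lra.
by rewrite /margin E1 E2 -mulf_div divff ?mul1r//; lra.
Qed.

Lemma margin_orbit y j : 0 < y -> margin (sorbit y j) = margin y.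
Proof.
by move=> y0; elim: j => // j IH; rewrite sorbitS margin_step// sorbit_gt0.
Qed.

Lemma margin_continuous y : 0 < y -> {for y, continuous margin}.
Proof.
move=> y0; have i0 : 0 < y^-1 by rewrite invr_gt0.
have cV (h : R -> R) : {for y^-1, continuous h} ->
    {for y, continuous (fun z : R => h z^-1)}.
  move=> ch; apply: (@continuous_comp _ _ _ (fun z : R => z^-1) h) => //.
  by apply: inv_continuous; lra.
apply: cvgM.
  apply: cvgD; first exact: (wsum_continuous down_ge0 down_le).
  apply: cvgM; first exact: cvg_id.
  exact/cV/(wsum_continuous up_ge0 up_le).
apply: cvgV; first by rewrite gt_eqF// m_span_gt0.
apply: cvgD; first exact: (wsum_continuous up_ge0 up_le).
apply: cvgM; first exact: cvg_id.
exact/cV/(wsum_continuous down_ge0 down_le).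
Qed.

(* [margin] descends to the circle of orbits of [step], where a value strictly
   between two others is attained on both arcs. *)
Lemma margin_two_orbits x y z : 0 < y -> 0 < z -> margin y < x -> x < margin z ->
  exists c d, [/\ 0 < c, 0 < d, margin c = x, margin d = x &
    forall j, c <> sorbit d j /\ d <> sorbit c j].
Proof.
move=> y0 z0 yx xz.
(* The margin is constant on orbits, so [z] may be replaced by a later point [z1] of its orbit below
   [y]. *)
have [N hN] := sorbit_lt_some z0 y0.
have [z1 [z10 z1y hz1]] : exists z1, [/\ 0 < z1, z1 < y & x < margin z1].
  by exists (sorbit z N); split => //; rewrite ?sorbit_gt0 ?margin_orbit.
(* The first entry of the orbit of [y] into [(0, z1]] places [z1] in the fundamental interval from
   [step u] to [u], whose ends have the same margin below [x]. *)
have [k [ky1 ky2]] : exists k, z1 < sorbit y k /\ sorbit y k.+1 <= z1.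
  have [M hM] := sorbit_lt_some y0 z10.
  have ex : exists M, sorbit y M <= z1 by exists M; exact: ltW.
  case: (ex_minnP ex) => -[|k] hk mk; first by move: hk; rewrite /sorbit/=; lra.
  exists k; split => //; rewrite ltNge; apply/negP => /mk; by rewrite ltnn.
pose u := sorbit y k; have u0 : 0 < u by exact: sorbit_gt0.
have Mu : margin u < x by rewrite margin_orbit.
have Msu : margin (step u) < x by rewrite margin_step.
have su0 := step_gt0 u0.
have cw a b : 0 < a -> {within `[a, b], continuous (@margin)}.
  move=> a0; apply: continuous_in_subspaceT => t; rewrite inE/= in_itv/= => /andP[at1 _].
  by apply: margin_continuous; lra.
have [c] := @IVT _ margin (step u) z1 x ky2 (cw _ _ su0)
  ltac:(by rewrite ge_min le_max (ltW Msu) (ltW hz1) orbT).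
rewrite in_itv/= => /andP[uc cz] Mc.
have [d] := @IVT _ margin z1 u x (ltW ky1) (cw _ _ z10)
  ltac:(by rewrite ge_min le_max (ltW Mu) (ltW hz1) orbT).
rewrite in_itv/= => /andP[zd du] Md.
have c0 : 0 < c by lra. have d0 : 0 < d by lra.
have {}cz : c < z1 by rewrite lt_neqAle cz andbT; apply/eqP => e; move: hz1; rewrite -e; lra.
have {}uc : step u < c by rewrite lt_neqAle uc andbT; apply/eqP => e; move: Msu; rewrite e; lra.
have {}du : d < u by rewrite lt_neqAle du andbT; apply/eqP => e; move: Mu; rewrite -e; lra.
have sd := step_lt d0 du.
(* The order is [step d < step u < c < z1 < d < u]: the orbit of [d] jumps over [c], and that of [c]
   stays below [d]. *)
exists c, d; split => // j; split => e.
  case: j e => [|j]; first by rewrite /sorbit/=; lra.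
  by rewrite sorbitSr; have := sorbit_le_self j (step_gt0 d0); lra.
by have := sorbit_le_self j c0; lra.
Qed.

End Margin.

(** * Solutions of the ABMN system *)

Section ABMN.
Variable R : realType.

(* The ABMN equations at a site determine its four adjacent increments; this
   collects those between two neighbouring sites, the first with data [a, b, m, n],
   the second with primed data. *)
Definition ABMN_bond (a b m n a' b' m' n' : R) : Prop :=
  [/\ m' - m = 2 * a + b, n - n' = b ^+ 2 / a,
      m' - m = a' ^+ 2 / b' & n - n' = 2 * b' + a'].

Lemma ABMN_bond_reflect (a b m n a' b' m' n' : R) :
  ABMN_bond a b m n a' b' m' n' -> ABMN_bond b' a' n' m' b a n m.
Proof. by move=> []. Qed.

(** For fixed stakes the equations are two linear systems, one in the increments of [m] and one in
    those of [n], nonsingular because [a + b] is positive. *)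
Lemma ABMN_site (a b ml m mr nl n nr : R) : 0 < a -> 0 < b ->
  ((a + b) * (m + a) = a * mr + b * ml /\ (a + b) * (n + b) = a * nr + b * nl /\
   (a + b) ^+ 2 = b * (mr - ml) /\ (a + b) ^+ 2 = a * (nl - nr)) <->
  (mr - m = 2 * a + b /\ n - nr = b ^+ 2 / a /\
   m - ml = a ^+ 2 / b /\ nl - n = 2 * b + a).
Proof.
move=> a0 b0; split.
  move=> [h1 [h2 [h3 h4]]].
  have e1 : m - ml = a ^+ 2 / b.
    suff <- : (m - ml) * b = a ^+ 2 by field; lra.
    apply: (@mulfI _ (a + b)); first by lra.
    have /= := congr1 ( *%R b) h1; have /= := congr1 ( *%R a) h3; lra.
  have e2 : n - nr = b ^+ 2 / a.
    suff <- : (n - nr) * a = b ^+ 2 by field; lra.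
    apply: (@mulfI _ (a + b)); first by lra.
    have /= := congr1 ( *%R a) h2; have /= := congr1 ( *%R b) h4; lra.
  have e3 : mr - ml = (a + b) ^+ 2 / b by rewrite h3; field; lra.
  have e4 : nl - nr = (a + b) ^+ 2 / a by rewrite h4; field; lra.
  split; last split => //; last split => //.
    have -> : mr - m = (mr - ml) - (m - ml) by ring.
    by rewrite e1 e3; field; lra.
  have -> : nl - n = (nl - nr) - (n - nr) by ring.
  by rewrite e2 e4; field; lra.
move=> [h1 [h2 [h3 h4]]].
have -> : mr = m + (2 * a + b) by lra.
have -> : nr = n - b ^+ 2 / a by lra.
have -> : ml = m - a ^+ 2 / b by lra.
have -> : nl = n + (2 * b + a) by lra.
by repeat split; field; lra.
Qed.

(** Regrouping the increments by pairs of neighbours gives a first-order recursion, which can be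
    solved outward from site 0. *)
Lemma ABMN_bondsP (a b m n : int -> R) :
  (forall i, 0 < a i) -> (forall i, 0 < b i) ->
  ((forall i, (a i + b i) * (m i + a i) = a i * m (i + 1) + b i * m (i - 1)) /\
   (forall i, (a i + b i) * (n i + b i) = a i * n (i + 1) + b i * n (i - 1)) /\
   (forall i, (a i + b i) ^+ 2 = b i * (m (i + 1) - m (i - 1))) /\
   (forall i, (a i + b i) ^+ 2 = a i * (n (i - 1) - n (i + 1)))) <->
  (forall i, ABMN_bond (a i) (b i) (m i) (n i)
                       (a (i + 1)) (b (i + 1)) (m (i + 1)) (n (i + 1))).
Proof.
move=> a0 b0; split.
  move=> [h1 [h2 [h3 h4]]] i.
  have [e1 [e2 _]] := (ABMN_site _ _ _ _ _ _ (a0 i) (b0 i)).1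
    (conj (h1 i) (conj (h2 i) (conj (h3 i) (h4 i)))).
  have [_ [_ [e3 e4]]] := (ABMN_site _ _ _ _ _ _ (a0 (i + 1)) (b0 (i + 1))).1
    (conj (h1 _) (conj (h2 _) (conj (h3 _) (h4 _)))).
  by rewrite addrK in e3 e4.
move=> h.
have H i : (a i + b i) * (m i + a i) = a i * m (i + 1) + b i * m (i - 1) /\
   (a i + b i) * (n i + b i) = a i * n (i + 1) + b i * n (i - 1) /\
   (a i + b i) ^+ 2 = b i * (m (i + 1) - m (i - 1)) /\
   (a i + b i) ^+ 2 = a i * (n (i - 1) - n (i + 1)).
  apply: (ABMN_site _ _ _ _ _ _ (a0 i) (b0 i)).2.
  have [e1 e2 _ _] := h i; have [_ _] := h (i - 1); rewrite subrK => e3 e4.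
  by [].
by split=> [i|]; [have := H i; tauto | split=> [i|]; [have := H i; tauto |
  split=> i; have := H i; tauto]].
Qed.

Definition half_line (A B M N : nat -> R) : Prop :=
  forall j, 0 < A j /\ 0 < B j /\
    ABMN_bond (A j) (B j) (M j) (N j) (A j.+1) (B j.+1) (M j.+1) (N j.+1).

(** Equating the two expressions of each increment gives [a' ^ 2 = (2 a + b) b'] and
    [b ^ 2 = a (2 b' + a')]; eliminating the scale leaves the recursion for the ratio. *)
Lemma ABMN_bond_step (a b m n a' b' m' n' : R) :
  0 < a -> 0 < b -> 0 < a' -> 0 < b' -> ABMN_bond a b m n a' b' m' n' ->
  b' / a' = step (b / a) /\ a' = a * gain (b / a).
Proof.
move=> a0 b0 a0' b0' [h1 h2 h3 h4].
have e1 : a' ^+ 2 = (2 * a + b) * b' by rewrite -h1 h3; field; lra.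
have e2 : b ^+ 2 = a * (2 * b' + a') by rewrite -h4 h2; field; lra.
have r : b' / a' = step (b / a).
  apply: step_unique; rewrite ?divr_gt0//.
  transitivity (b' * (2 * b' + a') * (2 * a + b) / (a' ^+ 2 * a)).
    by field; lra.
  rewrite e1.
  transitivity ((a * (2 * b' + a')) / a ^+ 2); first by field; lra.
  by rewrite -e2; field; lra.
split => //; rewrite /gain -r.
transitivity (a' ^+ 2 / a'); first by field; lra.
by rewrite e1; field; lra.
Qed.

Lemma half_lineE (A B M N : nat -> R) : half_line A B M N -> forall j,
  B j / A j = sorbit (B 0%N / A 0%N) j /\ A j = A 0%N * weight (B 0%N / A 0%N) j.
Proof.
move=> h; elim=> [|j [IH1 IH2]]; first by rewrite weight0 mulr1.
have [a0 [b0 hj]] := h j; have [a0' [b0' _]] := h j.+1.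
have [e1 e2] := ABMN_bond_step a0 b0 a0' b0' hj.
by rewrite sorbitS weightS mulrA -IH2 -IH1.
Qed.

Lemma half_line_cvg (A B M N : nat -> R) : half_line A B M N ->
  M @ \oo --> M 0%N + A 0%N * up_total (B 0%N / A 0%N) /\
  N @ \oo --> N 0%N - A 0%N * down_total (B 0%N / A 0%N).
Proof.
move=> h; set y := _ / _.
have [a0 [b0 _]] := h 0%N; have y0 : 0 < y by rewrite divr_gt0.
have E j : A j = A 0%N * weight y j /\ B j = A j * sorbit y j.
  have [e1 e2] := half_lineE h j; split => //; rewrite -e1.
  by have [? _] := h j; field; lra.
split.
  have eM : M = fun j => M 0%N + A 0%N * series (fun j => weight y j * (2 + sorbit y j)) j.
    apply/funext; elim=> [|j IH]; first by rewrite /series/= big_geq// mulr0 addr0.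
    rewrite /series/= big_nat_recr//= mulrDr addrA -[X in X + _]IH.
    have [_ [_ [e _ _ _]]] := h j; have [e1 e2] := E j.
    by rewrite -[M j.+1](subrK (M j)) e e2 e1; ring.
  rewrite {1}eM.
  by apply: cvgD; [exact: cvg_cst|apply: cvgMr; exact: (cvg_up_total y0)].
have eN : N = fun j => N 0%N - A 0%N * series (fun j => weight y j * sorbit y j ^+ 2) j.
  apply/funext; elim=> [|j IH]; first by rewrite /series/= big_geq// mulr0 subr0.
  rewrite /series/= big_nat_recr//= mulrDr opprD addrA -[X in X + _]IH.
  have [aj [_ [_ e _ _]]] := h j; have [e1 e2] := E j.
  have -> : N j.+1 = N j - (N j - N j.+1) by ring.
  by rewrite e e2; congr (_ - _); rewrite mulrA -e1; field; lra.
rewrite {1}eN.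
by apply: cvgB; [exact: cvg_cst|apply: cvgMr; exact: (cvg_down_total y0)].
Qed.

Lemma half_line_exists (a b m n : R) : 0 < a -> 0 < b ->
  exists A B M N : nat -> R, half_line A B M N /\
    [/\ A 0%N = a, B 0%N = b, M 0%N = m & N 0%N = n].
Proof.
move=> a0 b0; set y := b / a; have y0 : 0 < y by rewrite divr_gt0.
exists (fun j => a * weight y j), (fun j => a * weight y j * sorbit y j).
exists (fun j => m + a * series (fun j => weight y j * (2 + sorbit y j)) j).
exists (fun j => n - a * series (fun j => weight y j * sorbit y j ^+ 2) j).
split; last first.
  rewrite weight0 /series/= !big_geq//; split; rewrite ?mulr0 ?mulr1 ?subr0 ?addr0//.
  by rewrite /y; field; lra.
move=> j; have w0 := weight_gt0 j y0; have o0 := sorbit_gt0 j y0.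
have g0 := gain_gt0 o0; have s0 := step_gt0 o0.
split; first exact: mulr_gt0; split; first by rewrite !mulr_gt0.
rewrite /series/= !big_nat_recr//= weightS -/(sorbit y j).
have e := stepE o0.
set w := weight y j in w0 *; set o := sorbit y j in o0 g0 s0 e *.
move: (\sum_(0 <= _ < _) _) (\sum_(0 <= _ < _) _) => p q.
rewrite /gain; split.
- by ring.
- by field; lra.
- by field; lra.
- transitivity (a * w * o ^+ 2); first by ring.
  by rewrite -e; ring.
Qed.

Lemma ABMN_half_lines (a b m n : int -> R) (mm mp nm np : R) :
  ABMN_positive a b m n mm mp nm np ->
  half_line (fun k => a k%:Z) (fun k => b k%:Z) (fun k => m k%:Z) (fun k => n k%:Z) /\
  half_line (fun k => b (- k%:Z)) (fun k => a (- k%:Z))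
            (fun k => n (- k%:Z)) (fun k => m (- k%:Z)).
Proof.
move=> [a0 [b0 [h1 [h2 [h3 [h4 _]]]]]].
have h := (ABMN_bondsP m n a0 b0).1 (conj h1 (conj h2 (conj h3 h4))).
split=> j.
  by have := h j%:Z; rewrite -PoszD addn1.
split => //; split => //.
have := h (- j.+1%:Z); have -> : - j.+1%:Z + 1 = - j%:Z by lia.
exact: ABMN_bond_reflect.
Qed.

Lemma ABMN_margin (a b m n : int -> R) (mm mp nm np : R) :
  ABMN_positive a b m n mm mp nm np ->
  [/\ 0 < b 0 / a 0, mp - mm = a 0 * m_span (b 0 / a 0) &
      nm - np = a 0 * n_span (b 0 / a 0)].
Proof.
move=> H; have [hf hb] := ABMN_half_lines H.
have [Mf Nf] := half_line_cvg hf; have [Nb Mb] := half_line_cvg hb.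
case: H => a0 [b0 [_ [_ [_ [_ [cmp [cmm [cnp cnm]]]]]]]].
have := cvg_unique _ cmp Mf; have := cvg_unique _ cmm Mb.
have := cvg_unique _ cnp Nf; have := cvg_unique _ cnm Nb.
rewrite /= oppr0 => -> // -> // -> // -> //.
have := a0 0; have := b0 0 => b00 a00.
rewrite /m_span /n_span invf_div; split; first exact: divr_gt0.
  by field; lra.
by field; lra.
Qed.

Lemma mina_margins_margin (r : R) :
  mina_margins r -> exists2 y : R, 0 < y & r = margin y.
Proof.
move=> [a [b [m [n [mm [mp [nm [np [H ->]]]]]]]]].
have [y0 -> ->] := ABMN_margin H.
case: H => a0 _; exists (b 0 / a 0) => //.
by rewrite /margin -mulf_div divff ?mul1r// gt_eqF.
Qed.

Lemma ABMN_exists (y : R) : 0 < y -> exists a b m n : int -> R,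
  ABMN_positive a b m n 0 1 (margin y) 0 /\ b 0 / a 0 = y.
Proof.
move=> y0; have ms0 := m_span_gt0 y0.
have V0 : 0 < y^-1 by rewrite invr_gt0.
(* The scale makes the total rise of [m] equal to 1; [m0] and [n0] then make [m] vanish at minus
   infinity and [n] at plus infinity. *)
pose s := (m_span y)^-1; have s0 : 0 < s by rewrite invr_gt0.
have sy0 : 0 < s * y by rewrite mulr_gt0.
pose m0 := s * y * down_total y^-1; pose n0 := s * down_total y.
have [A [B [M [N [hf [A0 B0 M0 N0]]]]]] := half_line_exists m0 n0 s0 sy0.
have [B' [A' [N' [M' [hb [B'0 A'0 N'0 M'0]]]]]] := half_line_exists n0 m0 sy0 s0.
(* [Negz j] is [-(j + 1)], hence the index [j.+1]; the two half-lines agree at site 0, where they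
   are joined. *)
pose glue (F F' : nat -> R) (i : int) := match i with Posz j => F j | Negz j => F' j.+1 end.
have glueN F F' j : F 0%N = F' 0%N -> glue F F' (- j%:Z) = F' j by case: j.
have gN j : glue A A' (- j%:Z) = A' j by apply: glueN; congruence.
have gNB j : glue B B' (- j%:Z) = B' j by apply: glueN; congruence.
have gNM j : glue M M' (- j%:Z) = M' j by apply: glueN; congruence.
have gNN j : glue N N' (- j%:Z) = N' j by apply: glueN; congruence.
have ey : s * y / s = y by field; lra.
have es : s / (s * y) = y^-1 by field; lra.
exists (glue A A'), (glue B B'), (glue M M'), (glue N N'); split; last first.
  by rewrite -[glue B B' 0]/(B 0%N) -[glue A A' 0]/(A 0%N) A0 B0.
have [cM cN] := half_line_cvg hf; have [cN' cM'] := half_line_cvg hb.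
rewrite A0 B0 ey M0 N0 in cM cN; rewrite A'0 B'0 es M'0 N'0 in cM' cN'.
have a0 i : 0 < glue A A' i.
  by case: i => j; [have [] := hf j | have [_ []] := hb j.+1].
have b0 i : 0 < glue B B' i.
  by case: i => j; [have [_ []] := hf j | have [] := hb j.+1].
split => //; split => //.
have [|h1 [h2 [h3 h4]]] := (ABMN_bondsP (glue M M') (glue N N') a0 b0).2.
  case=> j; first by rewrite -PoszD addn1; have [_ [_]] := hf j.
  have -> : Negz j + 1 = - j%:Z by lia.
  rewrite gN gNB gNM gNN; have [_ [_]] := hb j; exact: ABMN_bond_reflect.
do 4 (split => //).
have -> : (fun k => glue M M' (- k%:Z)) = M' by apply/funext => k; rewrite gNM.
have -> : (fun k => glue N N' (- k%:Z)) = N' by apply/funext => k; rewrite gNN.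
have e1 : 1 = m0 + s * up_total y.
  rewrite /m0 /s; transitivity ((m_span y)^-1 * m_span y); first by field; lra.
  by rewrite /m_span; ring.
have e2 : 0 = m0 - s * y * down_total y^-1 by rewrite subrr.
have e3 : margin y = n0 + s * y * up_total y^-1.
  by rewrite /margin /n0 /s /n_span; ring.
have e4 : 0 = n0 - s * down_total y by rewrite subrr.
split; first by rewrite e1.
split; first by rewrite e2.
split; first by rewrite e4.
by rewrite e3.
Qed.

Lemma ABMN_ratio_orbit (a b m n : int -> R) (mm mp nm np : R) (i : int) j :
  ABMN_positive a b m n mm mp nm np ->
  b (i + j%:Z) / a (i + j%:Z) = sorbit (b i / a i) j.
Proof.
move=> [a0 [b0 [h1 [h2 [h3 [h4 _]]]]]].
have h := (ABMN_bondsP m n a0 b0).1 (conj h1 (conj h2 (conj h3 h4))).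
elim: j => [|j IH]; first by rewrite addr0.
have -> : i + j.+1%:Z = i + j%:Z + 1 by lia.
by rewrite sorbitS -IH; have [] := ABMN_bond_step (a0 _) (b0 _) (a0 _) (b0 _) (h (i + j%:Z)).
Qed.

(** A shift by [k >= 0] puts the first ratio at 0 on the forward orbit of the second; a negative
    shift does the converse. *)
Lemma ABMN_not_shift_equivalent (a b a' b' m' n' : int -> R) (mm' mp' nm' np' : R) :
  ABMN_positive a' b' m' n' mm' mp' nm' np' ->
  (forall j, b 0 / a 0 <> sorbit (b' 0 / a' 0) j /\
             b' 0 / a' 0 <> sorbit (b 0 / a 0) j) ->
  ~ shift_equivalent b a b' a'.
Proof.
move=> H' ne [k hk]; have [e1 e2] := hk 0; rewrite add0r in e1 e2.
case: k hk e1 e2 => j _ e1 e2.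
  apply: (ne j).1; rewrite -(ABMN_ratio_orbit 0 j H') add0r.
  by rewrite e1 e2.
apply: (ne j.+1).2; rewrite e1 e2 -(ABMN_ratio_orbit _ _ H').
by have -> : Negz j + j.+1%:Z = 0 by lia.
Qed.

End ABMN.

(** * Paths of finite cost *)

Section Paths.
Variable R : realType.
Implicit Types (u : (\bar R)^nat) (x : nat -> int) (v c : int -> R).

Lemma limn_esup_le u (l : \bar R) : (forall n, (u n <= l)%E) -> (limn_esup u <= l)%E.
Proof.
move=> ul; apply: (@le_trans _ _ (ereal_sup [set u n | n in setT])).
  by apply: ereal_inf_lbound; exists setT => //; exact: filterT.
by apply: ge_ereal_sup => _ [n _ <-].
Qed.

Lemma limn_einf_le u (l : \bar R) : (forall n, (u n <= l)%E) -> (limn_einf u <= l)%E.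
Proof. by move=> ul; apply: le_trans (limn_einf_sup u) (limn_esup_le ul). Qed.

Lemma limn_einf_ge u (l : \bar R) : (forall n, (l <= u n)%E) -> (l <= limn_einf u)%E.
Proof.
by move=> ul; rewrite /limn_einf leeNr; apply: limn_esup_le => n; rewrite leeN2.
Qed.

Lemma limn_esupNy u : limn_esup u = -oo%E -> u @ \oo --> -oo%E.
Proof.
move=> uNy; apply/cvgeNyPlt => A.
have : (limn_esup u < A%:E)%E by rewrite uNy ltNyr.
move=> /ereal_inf_lt[_ [V V1 <-] h]; apply: filterS V1 => n Vn.
by apply: le_lt_trans h; apply: ereal_sup_ubound; exists n.
Qed.

Lemma limn_einfy u : limn_einf u = +oo%E -> u @ \oo --> +oo%E.
Proof.
rewrite /limn_einf => /eqP; rewrite eqe_oppLR => /eqP /limn_esupNy /cvgeNyPlt h.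
by apply/cvgeyPgt => A; apply: filterS (h (- A)) => n; rewrite EFinN lteN2.
Qed.

Let pos x : (\bar R)^nat := fun n => ((x n)%:~R : R)%:E.

(** Integer levels allow induction on the level for paths with unit steps. *)
Lemma cvgNy_posP x : pos x @ \oo --> -oo%E <->
  forall M : nat, \forall n \near \oo, (x n <= - M%:Z)%R.
Proof.
split=> [/cvgeNyPle h M|h].
  have := h (- M%:R); apply: filterS => n.
  by rewrite lee_fin -[M%:R]/(M%:Z%:~R) -mulrNz ler_int.
apply/cvgeNyPle => A; have := h (Num.truncn `|A|).+1; apply: filterS => n.
rewrite -(@ler_int R) lee_fin => /le_trans; apply; rewrite mulrNz.
have := truncnS_gt `|A|; have := ler_norm (- A); rewrite normrN pmulrn.
by lra.
Qed.

Lemma cvgy_posP x : pos x @ \oo --> +oo%E <->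
  forall M : nat, \forall n \near \oo, (M%:Z <= x n)%R.
Proof.
split=> [/cvgeyPge h M|h].
  have := h (M%:R); apply: filterS => n.
  by rewrite lee_fin -[M%:R]/(M%:Z%:~R) ler_int.
apply/cvgeyPge => A; have := h (Num.truncn `|A|).+1; apply: filterS => n.
rewrite -(@ler_int R) lee_fin => h1; apply: le_trans h1.
have := truncnS_gt `|A|; have := ler_norm A; rewrite pmulrn; lra.
Qed.

Lemma cvg_value_Ny x v (l : R) : v (- k%:Z) @[k --> \oo] --> l ->
  pos x @ \oo --> -oo%E -> (v (x n))%:E @[n --> \oo] --> l%:E.
Proof.
move=> /cvgrPdist_le vl /cvgNy_posP h; apply: cvg_EFin; first exact: nearW.
apply/cvgrPdist_le => e e0; have [N _ hN] := vl e e0.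
have := h N; apply: filterS => n xn /=.
have -> : x n = - `|x n|%N%:Z by lia.
by apply: hN => /=; lia.
Qed.

Lemma cvg_value_y x v (l : R) : v k%:Z @[k --> \oo] --> l ->
  pos x @ \oo --> +oo%E -> (v (x n))%:E @[n --> \oo] --> l%:E.
Proof.
move=> /cvgrPdist_le vl /cvgy_posP h; apply: cvg_EFin; first exact: nearW.
apply/cvgrPdist_le => e e0; have [N _ hN] := vl e e0.
have := h N; apply: filterS => n xn /=.
have -> : x n = `|x n|%N%:Z by lia.
by apply: hN => /=; lia.
Qed.

(** Meant for deviating strategies, whose paths may fail to escape: there only the bound [vs <= v]
    is available. *)
Lemma terminal_le_limn_einf x v (vm vp vs : R) :
  v (- k%:Z) @[k --> \oo] --> vm -> v k%:Z @[k --> \oo] --> vp ->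
  (forall z, vs <= v z) ->
  (terminal x vm vp vs <= limn_einf (fun n => (v (x n))%:E))%E.
Proof.
move=> cm cp h; rewrite /terminal; case: ifPn => [/eqP/limn_esupNy e|_].
  by have [-> _] := cvg_limn_einf_sup (cvg_value_Ny cm e).
case: ifPn => [/eqP/limn_einfy e|_].
  by have [-> _] := cvg_limn_einf_sup (cvg_value_y cp e).
by apply: limn_einf_ge => n; rewrite lee_fin.
Qed.

(** The terms of a convergent series tend to 0, whereas each visit to [z] contributes [c z > 0]. *)
Lemma finite_cost_leaves x c z : (forall i, 0 < c i) ->
  (\sum_(1 <= t <oo) (c (x t.-1))%:E < +oo)%E ->
  \forall n \near \oo, x n != z.
Proof.
move=> c0 fin.
have cs : cvgn (series (fun t => c (x t))).
  apply: nondecreasing_is_cvgn.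
    apply/nondecreasing_seqP => n; rewrite /series/= big_nat_recr//= lerDl.
    exact: ltW.
  have C0 : (0 <= \sum_(1 <= t <oo) (c (x t.-1))%:E)%E.
    by apply: nneseries_ge0 => n _ _; rewrite lee_fin ltW.
  exists (fine (\sum_(1 <= t <oo) (c (x t.-1))%:E)%E) => _ [n _ <-].
  rewrite -lee_fin fineK ?ge0_fin_numE//.
  apply: le_trans (@nneseries_lim_ge _ _ _ _ n.+1 _); last first.
    by move=> i _ _; rewrite lee_fin ltW.
  by rewrite big_add1/= -sumEFin.
have /cvgrPdist_lt /(_ (c z) (c0 z)) := cvg_series_cvg_0 cs.
apply: filterS => n; rewrite sub0r normrN => h; apply/eqP => e.
by move: h; rewrite e gtr0_norm// ltxx.
Qed.

(* A path of finite cost leaves every site for good, hence eventually keeps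
   its sign, and then passes every level. *)
Lemma finite_cost_escapes x v c (vm vp vs : R) : (forall i, 0 < c i) ->
  v (- k%:Z) @[k --> \oo] --> vm -> v k%:Z @[k --> \oo] --> vp ->
  (forall n, x n.+1 = x n + 1 \/ x n.+1 = x n - 1) ->
  (\sum_(1 <= t <oo) (c (x t.-1))%:E < +oo)%E ->
  (v (x n))%:E @[n --> \oo] --> terminal x vm vp vs.
Proof.
move=> c0 cm cp ux fin; have lv z := finite_cost_leaves z c0 fin.
have [N _ hN] := lv 0.
have [pN|nN] := ltP 0 (x N).
  have pn n : (N <= n)%N -> 0 < x n.
    elim: n => [|n IH]; first by rewrite leqn0 => /eqP <-.
    rewrite leq_eqVlt => /predU1P[<-//|]; rewrite ltnS => Nn.
    by have := hN n.+1 (leqW Nn); have := IH Nn; have := ux n; lia.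
  have cy : pos x @ \oo --> +oo%E.
    apply/cvgy_posP; elim=> [|M IH].
      by exists N => // n /= /pn; lia.
    by apply: filterS2 IH (lv M%:Z) => n /=; lia.
  rewrite /terminal; have [e1 e2] := cvg_limn_einf_sup cy.
  by rewrite -/(pos x) e2 e1 /=; exact: cvg_value_y.
have nn n : (N <= n)%N -> x n < 0.
  elim: n => [|n IH].
    by rewrite leqn0 => /eqP e; have := hN N (leqnn N); rewrite -e /=; lia.
  rewrite leq_eqVlt => /predU1P[<-|]; first by have := hN N (leqnn N); rewrite /=; lia.
  rewrite ltnS => Nn.
  by have := hN n.+1 (leqW Nn); have := IH Nn; have := ux n; lia.
have cy : pos x @ \oo --> -oo%E.
  apply/cvgNy_posP; elim=> [|M IH].
    by exists N => // n /= /nn; lia.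
  by apply: filterS2 IH (lv (- M%:Z)) => n /=; lia.
rewrite /terminal; have [e1 e2] := cvg_limn_einf_sup cy.
by rewrite -/(pos x) e2 eqxx; exact: cvg_value_Ny.
Qed.

Lemma terminal_fin x (vm vp vs : R) : terminal x vm vp vs \is a fin_num.
Proof. by rewrite /terminal; case: ifP => // _; case: ifP. Qed.

End Paths.

(** * One-step law of the gameplay *)

Section Fibers.
Context (R : realType) (d : measure_display) (T : measurableType d).
Variables (P : probability T R) (X : nat -> T -> int).
Hypothesis mX : forall n z, measurable (X n @^-1` [set z]).
Implicit Types (f g : T -> \bar R) (A : set T).

Lemma measurable_fun_site n (h : int -> \bar R) :
  measurable_fun [set: T] (fun w => h (X n w)).
Proof.
move=> _ Y mY; rewrite setTI.
rewrite (_ : _ @^-1` Y = \bigcup_z (X n @^-1` [set z] `&` [set _ | Y (h z)])).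
  apply: countable_bigcupT_measurable; first exact: countableP.
  move=> z; have [Yz|Yz] := pselect (Y (h z)).
    by rewrite (_ : [set _ | _] = setT) ?setIT//; apply/seteqP; split.
  rewrite (_ : [set _ | _] = set0) ?setI0//; apply/seteqP; split => //.
by apply/seteqP; split=> [w Yw|w [z _ [/= -> //]]]; exists (X n w).
Qed.

(** Level sets of [X n] indexed by codes in [nat], so that sums over sites are series; an unattained
    code gives the empty set. *)
Let fiber n i := [set w | pickle (X n w) = i].

Lemma fiberP n i : fiber n i = set0 \/ exists z, fiber n i = X n @^-1` [set z].
Proof.
have [->|/set0P[w wi]] := eqVneq (fiber n i) set0; [by left|right].
exists (X n w); apply/seteqP; split=> [w' w'i|w' /= e] /=; last by rewrite /fiber /= e.
by apply: (pcan_inj pickleK); rewrite wi w'i.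
Qed.

Lemma measurable_fiber n i : measurable (fiber n i).
Proof. by have [->|[z ->]] := fiberP n i; [exact: measurable0|exact: mX]. Qed.

Lemma trivIset_fiber n : trivIset setT (fiber n).
Proof. by move=> i j _ _ [w [/= <- <-]]. Qed.

Lemma bigcup_fiber n : \bigcup_i fiber n i = setT.
Proof. by apply/seteqP; split=> // w _; exists (pickle (X n w)). Qed.

(** Takes the place of conditioning on [X n]: one-step estimates need only be proved on each level
    set. *)
Lemma le_integral_fibers n f g :
  measurable_fun setT f -> measurable_fun setT g ->
  (forall w, 0 <= f w)%E -> (forall w, 0 <= g w)%E ->
  (forall z, \int[P]_(w in X n @^-1` [set z]) f w <=
             \int[P]_(w in X n @^-1` [set z]) g w)%E ->
  (\int[P]_w f w <= \int[P]_w g w)%E.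
Proof.
move=> mf mg f0 g0 h; rewrite -(bigcup_fiber n).
rewrite !ge0_integral_bigcup ?bigcup_fiber//;
  try (by move=> i; exact: measurable_fiber); try exact: trivIset_fiber.
apply: lee_nneseries => [i _ _|i _]; first exact: integral_ge0.
by have [->|[z ->]] := fiberP n i; rewrite ?integral_set0.
Qed.

Lemma measure_fibers n A : measurable A ->
  P A = (\sum_(0 <= i <oo) P (A `&` fiber n i))%E.
Proof.
move=> mA; rewrite -measure_semi_bigcup.
- by rewrite -setI_bigcupr bigcup_fiber setIT.
- by move=> i; apply: measurableI => //; exact: measurable_fiber.
- exact/trivIset_setIl/trivIset_fiber.
- by rewrite -setI_bigcupr bigcup_fiber setIT.
Qed.

Lemma eq_measure_fibers n A B (r : R) : measurable A -> measurable B ->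
  (forall z, P (A `&` X n @^-1` [set z]) = r%:E * P (B `&` X n @^-1` [set z]))%E ->
  (P A = r%:E * P B)%E.
Proof.
move=> mA mB h; rewrite (measure_fibers n mA) (measure_fibers n mB) -nneseriesZl//.
by apply: eq_eseriesr => i _; have [->|[z ->]] := fiberP n i; rewrite ?setI0 ?measure0 ?mule0.
Qed.

End Fibers.

Section Law.
Context (R : realType) (d : measure_display) (T : measurableType d).
Variables (P : probability T R) (X : nat -> T -> int) (Sm Sp : strategy R) (k : int).
Hypothesis game : gameplay P X Sm Sp k.
Implicit Types (v : int -> R).

Let mX n z : measurable (X n @^-1` [set z]). Proof. exact: game.1. Qed.

Lemma measurable_cylinder (j n : nat) (xs : nat -> int) :
  measurable [set w | forall i, (j <= i <= n)%N -> X i w = xs i].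
Proof.
rewrite (_ : [set w | _] =
    \bigcap_i (if (j <= i <= n)%N then X i @^-1` [set xs i] else setT)).
  by apply: bigcap_measurable => // i _; case: ifP.
apply/seteqP; split=> [w h i _|w h i ji]; first by case: ifP => // ji; exact: h.
by have := h i Logic.I; rewrite ji.
Qed.

(* Summing the path probabilities over the positions before time [j]. *)
Lemma gameplay_cylinder (j n : nat) (xs : nat -> int) : (j <= n)%N ->
  (P [set w | forall i, (j <= i <= n.+1)%N -> X i w = xs i] =
   (trans Sm Sp n.+1 (xs n) (xs n.+1))%:E *
   P [set w | forall i, (j <= i <= n)%N -> X i w = xs i])%E.
Proof.
elim: j xs => [|j IH] xs jn.
  by rewrite !game.2 -EFinM (big_nat_recr n.+1)//= mulrA mulrC.
apply: (@eq_measure_fibers _ _ _ _ _ mX j); try exact: measurable_cylinder.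
move=> z; pose ys i := if i == j then z else xs i.
have E N : (j <= N)%N -> [set w | forall i, (j < i <= N)%N -> X i w = xs i] `&`
    X j @^-1` [set z] = [set w | forall i, (j <= i <= N)%N -> X i w = ys i].
  move=> jN; apply/seteqP; split=> [w [h1 h2] i /andP[ji iN]|w h].
    rewrite /ys; case: eqP => [->//|ij]; apply: h1; rewrite iN andbT ltn_neqAle ji andbT.
    by apply/eqP => e; exact: ij.
  split=> [i /andP[ji iN]|/=]; last by rewrite h ?leqnn// /ys eqxx.
  by rewrite h ?(ltnW ji)// /ys gtn_eqF.
rewrite !E ?(ltnW jn)//; last exact/leqW/ltnW.
rewrite IH ?(ltnW jn)// /ys !gtn_eqF//.
exact: ltnW.
Qed.

Lemma gameplay_step n (x y : int) :
  (P (X n @^-1` [set x] `&` X n.+1 @^-1` [set y]) =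
   (trans Sm Sp n.+1 x y)%:E * P (X n @^-1` [set x]))%E.
Proof.
have := @gameplay_cylinder n n (fun i => if i == n then x else y) (leqnn n).
rewrite eqxx gtn_eqF//.
rewrite (_ : [set w | _] = X n @^-1` [set x] `&` X n.+1 @^-1` [set y]); last first.
  apply/seteqP; split=> [w h|w [h1 h2] i /andP[]].
    split; first by have := h n; rewrite eqxx leqnn leqnSn; exact.
    by have := h n.+1; rewrite gtn_eqF// leqnn leqnSn; exact.
  by rewrite leq_eqVlt => /predU1P[<- _|ni iN]; rewrite ?eqxx// gtn_eqF//;
    have -> : i = n.+1 by apply/eqP; rewrite eqn_leq iN ni.
rewrite (_ : [set w | forall i, (n <= i <= n)%N -> _] = X n @^-1` [set x])//.
apply/seteqP; split=> [w h|w h i]; first by have := h n; rewrite eqxx leqnn; exact.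
by rewrite -eqn_leq => /eqP <-; rewrite eqxx.
Qed.

Lemma gameplay_init z : P (X 0%N @^-1` [set z]) = ((z == k)%:R)%:E.
Proof.
have := game.2 0%N (fun=> z); rewrite big_geq// mulr1 => <-; congr (P _).
apply/seteqP; split=> [w h i|w h]; last exact: h.
by rewrite leqn0 => /eqP ->.
Qed.

Let up n z := up_prob (Sm z n) (Sp z n).

(** Each level set splits into an upward move, a downward move and an exceptional rest. The rest is
    null because the first two already carry the full probability. *)
Let U n z := X n @^-1` [set z] `&` X n.+1 @^-1` [set z + 1].
Let D n z := X n @^-1` [set z] `&` X n.+1 @^-1` [set z - 1].
Let N n z := X n @^-1` [set z] `\` (U n z `|` D n z).

Let mU n z : measurable (U n z). Proof. exact: measurableI. Qed.
Let mD n z : measurable (D n z). Proof. exact: measurableI. Qed.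
Let mN n z : measurable (N n z). Proof. by apply: measurableD => //; exact: measurableU. Qed.

Let UD0 n z : U n z `&` D n z = set0.
Proof. by apply/seteqP; split => // w [[/= _ e1] [_ /= e2]]; lia. Qed.

Let PU n z : (P (U n z) = (up n.+1 z)%:E * P (X n @^-1` [set z]))%E.
Proof. by rewrite gameplay_step /trans eqxx. Qed.

Let PD n z : (P (D n z) = (1 - up n.+1 z)%:E * P (X n @^-1` [set z]))%E.
Proof.
rewrite gameplay_step /trans eqxx; case: eqP => //; lia.
Qed.

Let split_fiber n z : X n @^-1` [set z] = U n z `|` (D n z `|` N n z).
Proof.
apply/seteqP; split=> [w h|w [[]//|[[]//|[]//]]].
have [u|nu] := pselect (U n z w); [by left|right].
have [u|nu'] := pselect (D n z w); [by left|right].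
by split => // -[].
Qed.

Let PN n z : P (N n z) = 0%E.
Proof.
have h : (P (X n @^-1` [set z]) = P (U n z) + (P (D n z) + P (N n z)))%E.
  rewrite {1}split_fiber measureU//; last first.
  - apply/seteqP; split => // w [u [v|[_]]]; last by apply; left.
    by have : (U n z `&` D n z) w by []; rewrite UD0.
  - exact: measurableU.
  rewrite measureU//; apply/seteqP; split => // w [u [_]]; apply; by right.
move: h; rewrite PU PD.
have [p ->] : exists p : R, P (X n @^-1` [set z]) = p%:E.
  by exists (fine (P (X n @^-1` [set z]))); rewrite fineK// fin_num_measure.
have [q ->] : exists p : R, P (N n z) = p%:E.
  by exists (fine (P (N n z))); rewrite fineK// fin_num_measure.
rewrite -!EFinM -!EFinD => -[h]; congr (_%:E); lra.
Qed.

Lemma integral_step n z v : (forall i, 0 <= v i) ->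
  (\int[P]_(w in X n @^-1` [set z]) (v (X n.+1 w))%:E =
   (up n.+1 z * v (z + 1) + (1 - up n.+1 z) * v (z - 1))%:E * P (X n @^-1` [set z]))%E.
Proof.
move=> v0; have mv A : measurable_fun A (fun w => (v (X n.+1 w))%:E).
  by apply: (@measurable_funS _ _ _ _ setT) => //;
    exact: (measurable_fun_site mX n.+1 (EFin \o v)).
rewrite {1}split_fiber ge0_integral_setU//; last 3 first.
- exact: measurableU.
- by move=> w _; rewrite lee_fin.
- rewrite disj_set2E; apply/eqP/seteqP; split => // w [u [v'|[_]]]; last by apply; left.
  by have : (U n z `&` D n z) w by []; rewrite UD0.
rewrite ge0_integral_setU//; last 2 first.
- by move=> w _; rewrite lee_fin.
- rewrite disj_set2E; apply/eqP/seteqP; split => // w [u [_]]; apply; by right.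
rewrite (null_set_integral (mN n z))//; last exact: PN.
rewrite (eq_integral (cst (v (z + 1))%:E)); last by move=> w; rewrite inE => -[_ /= ->].
rewrite [X in (_ + (X + _))%E](eq_integral (cst (v (z - 1))%:E)); last first.
  by move=> w; rewrite inE => -[_ /= ->].
rewrite !integral_cst// adde0.
transitivity ((v (z + 1))%:E * P (U n z) + (v (z - 1))%:E * P (D n z))%E => //.
rewrite PU PD.
have [p ->] : exists p : R, P (X n @^-1` [set z]) = p%:E.
  by exists (fine (P (X n @^-1` [set z]))); rewrite fineK// fin_num_measure.
by rewrite -!EFinM -EFinD; congr (_%:E); ring.
Qed.

Lemma ae_unit_steps :
  \forall w \ae P, forall n, X n.+1 w = X n w + 1 \/ X n.+1 w = X n w - 1.
Proof.
apply/ae_foralln => n.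
pose A := \bigcup_z N n z.
have mA : measurable A by apply: countable_bigcupT_measurable; [exact: countableP|].
exists A; split => //.
  (* With factor 0, the fibrewise comparison reduces the claim to the nullity of each [N n z]. *)
  rewrite -[RHS](mul0e (P setT)); apply: (eq_measure_fibers mX (n := n)) => // z.
  rewrite mul0e (_ : A `&` _ = N n z) ?PN//.
  apply/seteqP; split=> [w [[z' _ h] /= e]|w h]; last first.
    by split; [exists z|exact: h.1].
  by have [/= e' _] := h; rewrite -e e'.
move=> w /= h; exists (X n w) => //; split => // -[[_ /= e]|[_ /= e]]; apply: h;
 by [left|right].
Qed.

End Law.

(** * Expected payoffs *)

Section ExpectedPayoff.
Context (R : realType) (d : measure_display) (T : measurableType d).
Variables (P : probability T R) (X : nat -> T -> int) (Sm Sp : strategy R) (k : int).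
Hypothesis game : gameplay P X Sm Sp k.
Variables (S : strategy R) (v : int -> R) (K vm vp vs : R).
Hypothesis S0 : is_strategy S.
Hypothesis v0 : forall z, 0 <= v z.
Hypothesis vK : forall z, v z <= K.
Hypothesis cvm : v (- j%:Z) @[j --> \oo] --> vm.
Hypothesis cvp : v j%:Z @[j --> \oo] --> vp.

Let up n z := up_prob (Sm z n) (Sp z n).
(** The mean of [v] after move [n + 1] from [z]. The section serves both players: [v] will be [m]
    for Maxine and [n] for Mina, with [S] the stakes of that player. *)
Let next n z := up n.+1 z * v (z + 1) + (1 - up n.+1 z) * v (z - 1).
Let mX n z : measurable (X n @^-1` [set z]). Proof. exact: game.1. Qed.

(** The range of [t] excludes [n], so [partial n.+1] is the cost of the first [n] moves. *)
Let partial n w : \bar R := (\sum_(1 <= t < n) (S (X t.-1 w) t)%:E)%E.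
Let cost w : \bar R := (\sum_(1 <= t <oo) (S (X t.-1 w) t)%:E)%E.
Let value n w : \bar R := (v (X n w))%:E.
Let stake n w : \bar R := (S (X n w) n.+1)%:E.
Let final w : \bar R := terminal (X ^~ w) vm vp vs.

Let m_value n : measurable_fun setT (value n).
Proof. exact: (measurable_fun_site mX n (EFin \o v)). Qed.

Let m_stake n : measurable_fun setT (stake n).
Proof. exact: (measurable_fun_site mX n (fun z => (S z n.+1)%:E)). Qed.

Let value_ge0 n w : (0 <= value n w)%E. Proof. by rewrite lee_fin. Qed.
Let stake_ge0 n w : (0 <= stake n w)%E. Proof. by rewrite lee_fin. Qed.

Let partialS n w : partial n.+2 w = (partial n.+1 w + stake n w)%E.
Proof. by rewrite /partial big_nat_recr. Qed.

Let m_partial n : measurable_fun setT (partial n).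
Proof.
case: n => [|n]; first by
  apply: (eq_measurable_fun (cst 0%E)) => // w _; rewrite /partial big_geq.
elim: n => [|n IH].
  by apply: (eq_measurable_fun (cst 0%E)) => // w _; rewrite /partial big_geq.
by apply: (eq_measurable_fun (partial n.+1 \+ stake n)%E) => [w _|];
  [rewrite partialS | exact: emeasurable_funD].
Qed.

Let partial_ge0 n w : (0 <= partial n w)%E.
Proof. by apply: sume_ge0 => t _; rewrite lee_fin. Qed.

Let partial_homo w : {homo partial ^~ w : n m / (n <= m)%N >-> (n <= m)%E}.
Proof.
by move=> n m nm; apply: lee_sum_nneg_natr => // t _ _; rewrite lee_fin.
Qed.

Let cvg_partial w : partial ^~ w @ \oo --> cost w.
Proof. by apply: is_cvg_nneseries => n _ _; rewrite lee_fin. Qed.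

Let m_cost : measurable_fun setT cost.
Proof. by apply: (emeasurable_fun_cvg partial) => // w _; exact: cvg_partial. Qed.

Let cost_ge0 w : (0 <= cost w)%E.
Proof. by apply: nneseries_ge0 => n _ _; rewrite lee_fin. Qed.

Let partial_le_cost n w : (partial n w <= cost w)%E.
Proof. by apply: nneseries_lim_ge => t _ _; rewrite lee_fin. Qed.

Let m_final : measurable_fun setT final.
Proof.
have mpos n : measurable_fun setT (fun w => ((X n w)%:~R : R)%:E).
  exact: (measurable_fun_site mX n (fun z => (z%:~R : R)%:E)).
have mesup := measurable_fun_limn_esup mpos.
rewrite /final /terminal; apply: measurable_fun_ifT => //.
  by apply: measurable_fun_eqe.
apply: measurable_fun_ifT => //; apply: measurable_fun_eqe => //.
rewrite /limn_einf; apply: measurableT_comp => //.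
apply: measurable_fun_limn_esup => n; exact: measurableT_comp.
Qed.

Let integral_value0 : (\int[P]_w value 0%N w)%E = (v k)%:E.
Proof.
have E z (h : T -> \bar R) (r : R) : (forall w, X 0%N w = z -> h w = r%:E) ->
    (\int[P]_(w in X 0%N @^-1` [set z]) h w = (r * (z == k)%:R)%:E)%E.
  move=> hr; rewrite (eq_integral (cst r%:E)); last first.
    by move=> w; rewrite inE => /= /hr.
  rewrite integral_cst//; transitivity (r%:E * P (X 0%N @^-1` [set z]))%E => //.
  by rewrite (gameplay_init game) -EFinM.
have e z : (\int[P]_(w in X 0%N @^-1` [set z]) value 0%N w =
            \int[P]_(w in X 0%N @^-1` [set z]) (cst (v k)%:E) w)%E.
  rewrite (E _ _ (v z)) => [|w /= <-//]; rewrite (E _ _ (v k))//.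
  by case: eqVneq => [->//|_]; rewrite !mulr0.
transitivity (\int[P]_w (cst (v k)%:E) w)%E; last first.
  rewrite integral_cst//; transitivity ((v k)%:E * P setT)%E => //.
  by rewrite probability_setT mule1.
by apply/eqP; rewrite eq_le; apply/andP; split;
  apply: (le_integral_fibers mX (n := 0%N)) => // z; rewrite ?lee_fin// e.
Qed.

Let fiber_current n z :
  (\int[P]_(w in X n @^-1` [set z]) (value n w + stake n w) =
   (v z + S z n.+1)%:E * P (X n @^-1` [set z]))%E.
Proof.
rewrite (eq_integral (cst (v z + S z n.+1)%:E)); first by rewrite integral_cst.
by move=> w; rewrite inE /value /stake => /= ->.
Qed.

Let integral_partialS n :
  (\int[P]_w partial n.+2 w = \int[P]_w partial n.+1 w + \int[P]_w stake n w)%E.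
Proof. by rewrite -ge0_integralD//; apply: eq_integral => w _; rewrite partialS. Qed.

Let integral_partial1 : (\int[P]_w partial 1%N w = 0)%E.
Proof. by apply: integral0_eq => w _; rewrite /partial big_geq. Qed.

Let m_current n : measurable_fun setT (fun w => value n w + stake n w)%E.
Proof. exact: emeasurable_funD. Qed.

Let current_ge0 n w : (0 <= value n w + stake n w)%E.
Proof. exact: adde_ge0. Qed.

(** The supermartingale property in mean, with the cost moved to the right so that every integrand
    is nonnegative. *)
Lemma integral_value_le n : (forall n z, next n z <= v z + S z n.+1) ->
  (\int[P]_w value n w <= (v k)%:E + \int[P]_w partial n.+1 w)%E.
Proof.
move=> drift; elim: n => [|n IH].
  by rewrite integral_value0 integral_partial1 adde0.
rewrite integral_partialS addeA.
apply: (@le_trans _ _ (\int[P]_w (value n w + stake n w))%E).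
  apply: (le_integral_fibers mX (n := n)) => // z.
  by rewrite fiber_current (integral_step game)// lee_wpmul2r// lee_fin drift.
by rewrite ge0_integralD// leeD2r.
Qed.

Lemma integral_value_eq n : (forall n z, next n z = v z + S z n.+1) ->
  (\int[P]_w value n w = (v k)%:E + \int[P]_w partial n.+1 w)%E.
Proof.
move=> drift; elim: n => [|n IH].
  by rewrite integral_value0 integral_partial1 adde0.
rewrite integral_partialS addeA -IH -ge0_integralD//.
by apply/eqP; rewrite eq_le; apply/andP; split;
  apply: (le_integral_fibers mX (n := n)) => // z;
  rewrite fiber_current (integral_step game)// -/(up _ _) -/(next n z) drift.
Qed.

Let integral_bounded (h : T -> \bar R) : measurable_fun setT h ->
  (forall w, 0 <= h w <= K%:E)%E -> (\int[P]_w h w <= K%:E)%E.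
Proof.
move=> mh hK; apply: (@le_trans _ _ (\int[P]_w (cst K%:E) w)%E).
  by apply: ge0_le_integral => // w _; have /andP[] := hK w.
rewrite integral_cst//; apply: (@le_trans _ _ (K%:E * P setT)%E) => //.
by rewrite probability_setT mule1.
Qed.

Let m_payoff : measurable_fun setT (fun w => payoff (X ^~ w) S vm vp vs).
Proof. by apply: emeasurable_funD => //; exact: measurableT_comp. Qed.

(** The inequality [- c + t <= l - c] written without subtraction, so that it survives integration
    when the cost [c] is infinite. *)
Lemma pos_neg_payoff (c t l : \bar R) : t \is a fin_num -> l \is a fin_num ->
  (0 <= c -> t <= l -> maxe (- c + t) 0 + c <= maxe (- (- c + t)) 0 + l)%E.
Proof.
case: t => // t _; case: l => // l _; case: c => [c| |]//.
  rewrite -[(- c%:E + t%:E)%E]/((- c + t)%:E) -[(- (- c + t)%:E)%E]/((- (- c + t))%:E).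
  rewrite -!EFin_max -!EFinD !lee_fin => c0 tl.
  by rewrite !maxEle; case: ifP; case: ifP; lra.
by move=> _ _; rewrite addNye//= maxye addye// leey.
Qed.

Lemma integral_payoff_le : (forall n z, next n z <= v z + S z n.+1) ->
  vs <= 0 -> (\int[P]_w payoff (X ^~ w) S vm vp vs <= (v k)%:E)%E.
Proof.
move=> drift vs0.
set f := fun w => payoff (X ^~ w) S vm vp vs.
(* [L] dominates the terminal payment on every path, lies between 0 and [K], and is controlled in
   mean by Fatou's lemma. *)
pose L w : \bar R := limn_einf (value ^~ w).
have L0 w : (0 <= L w)%E by exact: limn_einf_ge.
have LK w : (L w <= K%:E)%E by apply: limn_einf_le => n; rewrite lee_fin.
have mL : measurable_fun setT L.
  rewrite /L /limn_einf; apply: measurableT_comp => //.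
  by apply: measurable_fun_limn_esup => n; exact: measurableT_comp.
have TL w : (final w <= L w)%E.
  by apply: terminal_le_limn_einf => // z; exact: le_trans vs0 (v0 z).
have IL : (\int[P]_w L w <= (v k)%:E + \int[P]_w cost w)%E.
  apply: le_trans (fatou P measurableT m_value (fun n w _ => value_ge0 n w)) _.
  apply: limn_einf_le => n; apply: le_trans (integral_value_le n drift) _.
  by rewrite leeD2l//; exact: ge0_le_integral.
have LE : (\int[P]_w L w <= K%:E)%E.
  by apply: integral_bounded => // w; rewrite L0 LK.
have fin_L w : L w \is a fin_num by rewrite ge0_fin_numE// (le_lt_trans (LK w))// ltry.
have fE w : f w = (- cost w + final w)%E by [].
have mp : measurable_fun setT f^\+%E by exact: measurable_funepos.
have mn : measurable_fun setT f^\-%E by exact: measurable_funeneg.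
have pn : (\int[P]_w f^\+%E w + \int[P]_w cost w <= \int[P]_w f^\-%E w + \int[P]_w L w)%E.
  rewrite -!ge0_integralD//; apply: ge0_le_integral => //.
  - by move=> w _; exact: adde_ge0.
  - exact: emeasurable_funD.
  - exact: emeasurable_funD.
  - by move=> w _; rewrite funeposE funenegE fE; apply: pos_neg_payoff => //; exact: terminal_fin.
have pL : (\int[P]_w f^\+%E w <= \int[P]_w L w)%E.
  apply: ge0_le_integral => // w _; rewrite funeposE ge_max L0 andbT fE.
  by rewrite -[leRHS]add0e leeD// leeNl oppe0.
rewrite integralE.
have p0 : (0 <= \int[P]_w f^\+%E w)%E by exact: integral_ge0.
have n0 : (0 <= \int[P]_w f^\-%E w)%E by exact: integral_ge0.
have c0 : (0 <= \int[P]_w cost w)%E by exact: integral_ge0.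
have l0 : (0 <= \int[P]_w L w)%E by exact: integral_ge0.
move: (\int[P]_w f^\+%E w)%E (\int[P]_w f^\-%E w)%E (\int[P]_w cost w)%E (\int[P]_w L w)%E
  p0 n0 c0 l0 pn pL LE IL => p q c l.
(* [LE] and [pL] make [l] and [p] finite. If [q] is infinite the expected payoff is minus infinity;
   otherwise [pn] forces [c] to be finite and the claim is linear. *)
case: l => [l| |]//; case: p => [p| |]// _ q0 c0 _ h1 h2 h3 h4.
case: q q0 h1 => [q| |]//= _ h1; last by rewrite addeNy leNye.
case: c c0 h1 h4 => [c| |]//= _ h1 h4.
by move: h1 h2 h3 h4; rewrite -!EFinD !lee_fin; lra.
Qed.

(* A bounded value process pays for the expected total stake, so almost every
   path has finite cost and therefore escapes. *)
Lemma integral_payoff_eq (c : int -> R) : (forall i, 0 < c i) ->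
  (forall z t, S z t = c z) -> (forall n z, next n z = v z + S z n.+1) ->
  (\int[P]_w payoff (X ^~ w) S vm vp vs = (v k)%:E)%E.
Proof.
move=> c0 Sc drift.
have cJ : (\int[P]_w partial n w)%E @[n --> \oo] --> (\int[P]_w cost w)%E.
  by apply: (cvg_monotone_convergence measurableT m_partial) => // w _; exact: partial_homo.
have J n : (\int[P]_w partial n.+1 w <= K%:E)%E.
  apply: (@le_trans _ _ (\int[P]_w value n w)%E).
    by rewrite (integral_value_eq n drift) leeDr// lee_fin.
  by apply: integral_bounded => // w; rewrite value_ge0 lee_fin vK.
have cJ' : (\int[P]_w partial n.+1 w)%E @[n --> \oo] --> (\int[P]_w cost w)%E.
  by have := cJ; rewrite -cvg_shiftS.
have IC : (\int[P]_w cost w <= K%:E)%E.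
  rewrite -(cvg_lim _ cJ')//; apply: lime_le; first by apply/cvg_ex; eexists; exact: cJ'.
  exact: nearW.
have intC : P.-integrable setT cost.
  apply/integrableP; split => //.
  rewrite (eq_integral cost) => [|w _]; last by rewrite gee0_abs.
  by rewrite (le_lt_trans IC)// ltry.
have cv : \forall w \ae P, [set: T] w -> value ^~ w @ \oo --> final w.
  apply: filterS2 (integrable_ae measurableT intC) (ae_unit_steps game) => w h1 h2 _.
  apply: (finite_cost_escapes (c := c)) => //.
  have := h1 Logic.I; rewrite ge0_fin_numE//; congr (_ < _)%E.
  by apply: eq_eseriesr => t _; rewrite Sc.
have intK : P.-integrable setT (EFin \o cst K).
  exact: finite_measure_integrable_cst.
have bd : \forall w \ae P, forall n, [set: T] w -> (`|value n w| <= (EFin \o cst K) w)%E.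
  by apply: aeW => w n _; rewrite gee0_abs// lee_fin.
have [intF _ cI] := dominated_convergence measurableT m_value m_final cv intK bd.
(* The limit of [integral_value_eq]: dominated convergence on the left, monotone convergence on the
   right. *)
have e : (\int[P]_w final w = (v k)%:E + \int[P]_w cost w)%E.
  apply: (cvg_unique _ cI) => //.
  rewrite (_ : [sequence _]_n = fun n => ((v k)%:E + \int[P]_w partial n.+1 w)%E); last first.
    by apply/funext => n; exact: integral_value_eq.
  by apply: cvgeD => //; exact: cvg_cst.
have -> : (\int[P]_w payoff (X ^~ w) S vm vp vs = \int[P]_w (final w - cost w))%E.
  by apply: eq_integral => w _; rewrite addeC.
rewrite integralB// e addeK//.
by rewrite ge0_fin_numE ?integral_ge0// (le_lt_trans IC)// ltry.
Qed.

End ExpectedPayoff.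

(** * Best responses and the two equilibria *)

Section Equilibrium.
Variable R : realType.

Lemma up_prob_mul_le (s t x y z : R) : 0 < s + t ->
  t * x + s * y <= (s + t) * z ->
  up_prob s t * x + (1 - up_prob s t) * y <= z.
Proof.
move=> st h; rewrite /up_prob gt_eqF// -(ler_pM2l st).
by apply: le_trans h; rewrite le_eqVlt; apply/orP; left; apply/eqP; field; lra.
Qed.

Lemma up_prob_mul_eq (s t x y z : R) : 0 < s + t ->
  t * x + s * y = (s + t) * z ->
  up_prob s t * x + (1 - up_prob s t) * y = z.
Proof.
move=> st h; rewrite /up_prob gt_eqF//.
transitivity ((t * x + s * y) / (s + t)); first by field; lra.
by rewrite h; field; lra.
Qed.

(** Increments have constant sign, so [m] rises and [n] falls along the line and both stay between
    their limits. *)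
Lemma ABMN_bounds (a b m n : int -> R) (mm mp nm np : R) :
  ABMN_positive a b m n mm mp nm np ->
  (forall i, mm <= m i <= mp) /\ (forall i, np <= n i <= nm).
Proof.
move=> H; have [hf hb] := ABMN_half_lines H.
case: H => a0 [b0 [_ [_ [_ [_ [cmp [cmm [cnp cnm]]]]]]]].
have mono (A B M N : nat -> R) : half_line A B M N ->
    nondecreasing_seq M /\ nonincreasing_seq N.
  move=> h; split; [apply/nondecreasing_seqP|apply/nonincreasing_seqP] => j;
    have [h1 [h2 [e1 e2 e3 e4]]] := h j; first by lra.
  by have [h3 [h4 _]] := h j.+1; lra.
have [M1 N1] := mono _ _ _ _ hf; have [N2 M2] := mono _ _ _ _ hb.
have u1 j : m j%:Z <= mp.
  by rewrite -(cvg_lim _ cmp)//; apply: nondecreasing_cvgn_le => //; apply/cvg_ex; exists mp.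
have u2 j : n (- j%:Z) <= nm.
  by rewrite -(cvg_lim _ cnm)//; apply: nondecreasing_cvgn_le => //; apply/cvg_ex; exists nm.
have l1 j : np <= n j%:Z.
  by rewrite -(cvg_lim _ cnp)//; apply: nonincreasing_cvgn_ge => //; apply/cvg_ex; exists np.
have l2 j : mm <= m (- j%:Z).
  by rewrite -(cvg_lim _ cmm)//; apply: nonincreasing_cvgn_ge => //; apply/cvg_ex; exists mm.
have := M1 0%N; have := N1 0%N; have := M2 0%N; have := N2 0%N => a1 a2 a3 a4.
have m0 := l2 0%N; have m0' := u1 0%N; have n0 := l1 0%N; have n0' := u2 0%N.
rewrite oppr0 in m0 n0'.
split=> -[j|j]; rewrite ?NegzE; apply/andP; split.
- by have := a4 j (leq0n j); lra.
- exact: u1.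
- exact: l2.
- by have := a2 j.+1 (leq0n _); rewrite oppr0; lra.
- exact: l1.
- by have := a3 j (leq0n j); lra.
- by have := a1 j.+1 (leq0n _); rewrite oppr0; lra.
- exact: u2.
Qed.

Lemma ABMN_nash (a b m n : int -> R) (x mstar nstar : R) :
  mstar <= 0 -> nstar <= 0 -> ABMN_positive a b m n 0 1 x 0 ->
  nash_equilibrium (standard_game x mstar nstar) (ti_strategy b) (ti_strategy a).
Proof.
move=> ms ns H; have [bm bn] := ABMN_bounds H.
have [a0 [b0 [h1 [h2 [h3 [h4 [cmp [cmm [cnp cnm]]]]]]]]] := H.
have E i := (ABMN_site (m (i - 1)) (m i) (m (i + 1)) (n (i - 1)) (n i) (n (i + 1))
  (a0 i) (b0 i)).1 (conj (h1 i) (conj (h2 i) (conj (h3 i) (h4 i)))).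
have mr i : m (i + 1) = m i + (2 * a i + b i) by have [? _] := E i; lra.
have ml i : m (i - 1) = m i - a i ^+ 2 / b i by have [_ [_ [? _]]] := E i; lra.
have nl i : n (i - 1) = n i + (2 * b i + a i) by have [_ [_ [_ ?]]] := E i; lra.
have nr i : n (i + 1) = n i - b i ^+ 2 / a i by have [_ [? _]] := E i; lra.
have m0 z : 0 <= m z by have /andP[] := bm z.
have m1 z : m z <= 1 by have /andP[] := bm z.
have n0 z : 0 <= n z by have /andP[] := bn z.
have nx z : n z <= x by have /andP[] := bn z.
have sa : is_strategy (ti_strategy a) by move=> i t; exact: (ltW (a0 i)).
have sb : is_strategy (ti_strategy b) by move=> i t; exact: (ltW (b0 i)).
split => //; split => // S S0 k; split=> d1 T1 P1 X d2 T2 P2 Y gX gY.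
- rewrite /maxine_payoff/=.
  rewrite (integral_payoff_eq gX mstar sa m0 m1 cmm cmp a0)//; last first.
    move=> t z; rewrite /ti_strategy; apply: up_prob_mul_eq.
      by have := a0 z; have := b0 z; lra.
    by rewrite mr ml; have := b0 z => ?; field; lra.
  apply: (integral_payoff_le gY S0 m0 m1 cmm cmp) => // t z.
  rewrite /ti_strategy; have := S0 z t.+1; have := b0 z; have := a0 z.
  move: (S z t.+1) => s az bz s0; apply: up_prob_mul_le; first by lra.
  (* The slack times the total stake is the square [(s - a z) ^ 2], which singles out [a z] as the
     best response. *)
  rewrite mr ml -subr_ge0 (_ : _ - _ = (s - a z) ^+ 2) ?sqr_ge0//; by field; lra.
- rewrite /mina_payoff/=.
  rewrite (integral_payoff_eq gX nstar sb n0 nx cnm cnp b0)//; last first.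
    move=> t z; rewrite /ti_strategy; apply: up_prob_mul_eq.
      by have := a0 z; have := b0 z; lra.
    by rewrite nr nl; have := a0 z => ?; field; lra.
  apply: (integral_payoff_le gY S0 n0 nx cnm cnp) => // t z.
  rewrite /ti_strategy; have := S0 z t.+1; have := b0 z; have := a0 z.
  move: (S z t.+1) => s az bz s0; apply: up_prob_mul_le; first by lra.
  rewrite nr nl -subr_ge0 (_ : _ - _ = (s - b z) ^+ 2) ?sqr_ge0//; by field; lra.
Qed.

Lemma mina_margins_gt0 (r : R) : mina_margins r -> 0 < r.
Proof. by move=> /mina_margins_margin[y y0 ->]; exact: margin_gt0. Qed.

Lemma margin_mina_margins (y : R) : 0 < y -> mina_margins (margin y).
Proof.
move=> y0; have [a [b [m [n [H _]]]]] := ABMN_exists y0.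
by exists a, b, m, n, 0, 1, (margin y), 0; split; rewrite ?subr0 ?divr1.
Qed.

Lemma lambda_ABMN_lt (x : R) : lambda_ABMN R < x -> exists2 y : R, 0 < y & margin y < x.
Proof.
move=> lx; have [|r /mina_margins_margin[y y0 ->] yx] := inf_lt _ lx.
  by exists (margin 1); exact: margin_mina_margins.
by exists y.
Qed.

Lemma lambda_ABMN_ge0 : 0 <= lambda_ABMN R.
Proof.
apply: lb_le_inf; first by exists (margin 1); exact: margin_mina_margins.
by move=> r /mina_margins_gt0/ltW.
Qed.

End Equilibrium.

Theorem mainTheorem5 (R : realType) (mstar nstar : R) :
  mstar <= 0 -> nstar <= 0 ->
  forall x : R, lambda_ABMN R < x < (lambda_ABMN R)^-1 ->
  exists (b a b' a' : int -> R),
    nash_equilibrium (standard_game x mstar nstar) (ti_strategy b) (ti_strategy a) /\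
    nash_equilibrium (standard_game x mstar nstar) (ti_strategy b') (ti_strategy a') /\
    ~ shift_equivalent b a b' a'.
Proof.
move=> ms ns x /andP[lx xl].
have l0 := lambda_ABMN_ge0 R; have x0 : 0 < x by exact: le_lt_trans lx.
(* The infimum is only known to be nonnegative here; at 0 the claim is positivity of [x^-1]. *)
have lx' : lambda_ABMN R < x^-1.
  move: l0; rewrite le_eqVlt => /predU1P[e|l0]; first by rewrite -e invr_gt0.
  by rewrite -[ltLHS]invrK ltf_pV2// posrE invr_gt0.
have [y y0 yx] := lambda_ABMN_lt lx; have [z z0 zx] := lambda_ABMN_lt lx'.
have zV0 : 0 < z^-1 by rewrite invr_gt0.
(* The margin of [z] is below [x^-1], and exchanging the players inverts it. *)
have xz : x < margin z^-1.
  by rewrite marginV// -[ltLHS]invrK ltf_pV2// posrE ?invr_gt0// margin_gt0.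
have [c [c' [c0 c'0 Mc Mc' ne]]] := margin_two_orbits y0 zV0 yx xz.
have [a [b [m [n [H e]]]]] := ABMN_exists c0.
have [a' [b' [m' [n' [H' e']]]]] := ABMN_exists c'0.
rewrite Mc in H; rewrite Mc' in H'.
exists b, a, b', a'; split; first exact: ABMN_nash H.
split; first exact: ABMN_nash H'.
by apply: ABMN_not_shift_equivalent H' _ => j; rewrite e e'.
Qed.
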